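(* Consider the Euler equations with gravitation ($\omega=\phi$) or the Ripa model ($\omega=b$), written as $\boldsymbol U(\boldsymbol V)_t+\nabla\cdot\boldsymbol F(\boldsymbol U(\boldsymbol V))=\boldsymbol r(\boldsymbol U(\boldsymbol V),\omega)$ in terms of the equilibrium variables $\boldsymbol V$. The semi-discrete discontinuous Galerkin method: find $\boldsymbol V\in\boldsymbol{\mathcal V}_h^k$ such that for every cell $\mathcal T\in\mathcal K$ and every test function $\boldsymbol\varphi\in\boldsymbol{\mathcal V}_h^k$ $$\frac{d}{dt}\int_{\mathcal T}\boldsymbol U(\boldsymbol V)\cdot\boldsymbol\varphi\,d\boldsymbol x=\mathrm{RHS}(\boldsymbol V,\omega,\boldsymbol\varphi),$$ $$\mathrm{RHS}(\boldsymbol V,\omega,\boldsymbol\varphi)=\int_{\mathcal T}\boldsymbol F(\boldsymbol U(\boldsymbol V)):\nabla\boldsymbol\varphi\,d\boldsymbol x-\int_{\partial\mathcal T}\widehat{\boldsymbol F}^{*}\cdot\boldsymbol\varphi^{int_{\mathcal T}}\,ds+\int_{\mathcal T}\boldsymbol r(\boldsymbol U(\boldsymbol V),\omega)\cdot\boldsymbol\varphi\,d\boldsymbol x,$$ with the hydrostatic reconstruction numerical flux $$\widehat{\boldsymbol F}^{*}=\widehat{\boldsymbol F}(\boldsymbol U^{*,int_{\mathcal T}},\boldsymbol U^{*,ext_{\mathcal T}},\boldsymbol n)-\boldsymbol F(\boldsymbol U^{*,int_{\mathcal T}})\cdot\boldsymbol n+\boldsymbol F(\boldsymbol U^{int_{\mathcal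 T}})\cdot\boldsymbol n,$$ is exact for one-dimensional moving equilibria and two-dimensional hydrostatic equilibrium states; that is, if the initial values are in such an exact equilibrium state, then $\mathrm{RHS}(\boldsymbol V,\omega,\boldsymbol\varphi)=0$ for every cell and every test function, so the state is preserved.
   Context: **Mesh and spaces.** $\mathcal K$ is a partition of the computational domain $\Omega\subset\mathbb R^d$ into cells $\mathcal T$ (intervals if $d=1$, rectangles $[x_{i-1/2},x_{i+1/2}]\times[y_{j-1/2},y_{j+1/2}]$ if $d=2$). $\mathcal W_h^k=\{w: w|_{\mathcal T}\in P^k(\mathcal T)\ \forall\mathcal T\in\mathcal K\}$, where $P^k(\mathcal T)$ is the space of polynomials of degree at most $k$ on $\mathcal T$; $\boldsymbol{\mathcal V}_h^k$ is the space of vectors with $d+2$ components in $\mathcal W_h^k$. $\boldsymbol n$ is the outward unit normal on $\partial\mathcal T$. For $\boldsymbol x\in\partial\mathcal T$, $u^{int_{\mathcal T}}(\boldsymbol x)=\lim_{\epsilon\to0^+}u(\boldsymbol x-\epsilon\boldsymbol n)$ and $u^{ext_{\mathcal T}}(\boldsymbol x)=\lim_{\epsilon\to0^+}u(\boldsymbol x+\epsilon\boldsymbol n)$. ''$\cdot$'' is the Euclidean dot product and ''$:$'' the Frobenius inner product. **Euler with gravitation** (ideal gas, ratio of specific heats $\gamma$). $\rho_t+\nabla\cdot(\rho\boldsymbol u)=0$, $(\rho\boldsymbol u)_t+\nabla\cdot(\rho\boldsymbol u\otimes\boldsymbol u+p\mathbf I_d)=-\rho\nabla\phi$, $E_t+\nabla\cdot((E+p)\boldsymbol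 u)=-\rho\boldsymbol u\cdot\nabla\phi$, with density $\rho$, velocity $\boldsymbol u$, pressure $p=(\gamma-1)(E-\tfrac12\rho\|\boldsymbol u\|^2)$, total energy $E$, identity matrix $\mathbf I_d$, and time-independent gravitational potential $\phi=\phi(\boldsymbol x)$. Conservative variables $\boldsymbol U=(\rho,\rho\boldsymbol u,E)$; equilibrium variables $\boldsymbol V=(K,\rho\boldsymbol u,\varepsilon)$ with $$K=\frac p{\rho^\gamma},\qquad \varepsilon=\frac{\|\rho\boldsymbol u\|^2}{2\rho^2}+\frac{\gamma}{\gamma-1}\frac p\rho+\phi.$$ Inverse map $\boldsymbol U(\boldsymbol V,\phi)$: $\rho$ is the correct root of $\frac{\|\rho\boldsymbol u\|^2}{2\rho^2}+\frac{\gamma}{\gamma-1}K\rho^{\gamma-1}+\phi-\varepsilon=0$ with $\rho\boldsymbol u$ given, and $E=\frac{\|\rho\boldsymbol u\|^2}{2\rho}+\frac1{\gamma-1}K\rho^\gamma$. For zero momentum, $\rho=\left(\frac{\gamma-1}{K\gamma}(\varepsilon-\phi)\right)^{1/(\gamma-1)}$. For nonzero momentum, with $\rho_\star=\left(\|\rho\boldsymbol u\|^2/(\gamma K)\right)^{1/(\gamma+1)}$, one selects $\rho>\rho_\star$ for subsonic flow (Mach number $\|\boldsymbol u\|/\sqrt{\gamma K\rho^{\gamma-1}}<1$), $\rho<\rho_\star$ for supersonic flow (Mach number $>1$), and $\rho=\rho_\star$ at Mach number $1$. The map between $\boldsymbol U$ and $\boldsymbol V$ is one-to-one under the determined Mach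 number regime. **Ripa model.** In 2D: $h_t+(hu)_x+(hv)_y=0$, $(hu)_t+(hu^2+\frac12gh^2\theta)_x+(huv)_y=-gh\theta b_x$, $(hv)_t+(huv)_x+(hv^2+\frac12gh^2\theta)_y=-gh\theta b_y$, $(h\theta)_t+(hu\theta)_x+(hv\theta)_y=0$; in 1D drop $v$ and the $y$-derivatives. Here $h$ is water height, $(u,v)$ velocity, $\theta$ the potential temperature field, $g$ the gravitational constant, $b$ the bottom topography. Conservative variables $\boldsymbol U=(h,hu,hv,h\theta)$ (1D: $(h,hu,h\theta)$); equilibrium variables $\boldsymbol V=(E,hu,hv,\theta)$ (1D: $(E,hu,\theta)$) with $E=\frac{(hu)^2+(hv)^2}{2h^2}+g\theta(h+b)$ ($hv=0$ in 1D). Inverse map $\boldsymbol U(\boldsymbol V,b)$: $h$ is the correct (physically relevant) root of $g\theta h^3-(E-gb\theta)h^2+\frac12((hu)^2+(hv)^2)=0$ with the discharges given; for zero discharge $h=\frac E{g\theta}-b$; for nonzero discharge the smaller positive root is supercritical, the larger is subcritical, and they coincide at the sonic point. The regime is determined by the Froude number (in 1D $|u|/\sqrt{gh\theta}$), and the map is one-to-one under the determined Froude number regime. $\boldsymbol U(\boldsymbol V)$ abbreviates $\boldsymbol U(\boldsymbol V,\omega)$; $\boldsymbol F$ and $\boldsymbol r$ are the flux and source of the system. **Interface values and flux.** With $\omega^*=\max(\omega^{int_{\mathcal T}},\omega^{ext_{\mathcal T}})$: $\boldsymbol U^{int_{\mathcal T}}=\boldsymbol U(\boldsymbol V^{int_{\mathcal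 T}},\omega^{int_{\mathcal T}})$, $\boldsymbol U^{ext_{\mathcal T}}=\boldsymbol U(\boldsymbol V^{ext_{\mathcal T}},\omega^{ext_{\mathcal T}})$, $\boldsymbol U^{*,int_{\mathcal T}}=\boldsymbol U(\boldsymbol V^{int_{\mathcal T}},\omega^* )$, $\boldsymbol U^{*,ext_{\mathcal T}}=\boldsymbol U(\boldsymbol V^{ext_{\mathcal T}},\omega^* )$. The numerical flux $\widehat{\boldsymbol F}$ is consistent, $\widehat{\boldsymbol F}(\boldsymbol U,\boldsymbol U,\boldsymbol n)=\boldsymbol F(\boldsymbol U)\cdot\boldsymbol n$. It is chosen as the Lax–Friedrichs flux $\widehat{\boldsymbol F}(\boldsymbol U^{int},\boldsymbol U^{ext},\boldsymbol n)=\frac12\left(\boldsymbol F(\boldsymbol U^{int})\cdot\boldsymbol n+\boldsymbol F(\boldsymbol U^{ext})\cdot\boldsymbol n-\alpha(\boldsymbol U^{ext}-\boldsymbol U^{int})\right)$, $\alpha=\max_{\boldsymbol U}\left|\frac{\partial\boldsymbol F}{\partial\boldsymbol U}\cdot\boldsymbol n\right|$ (global maximum). If isolated flow discontinuities exist, the Roe flux, or the HLLC flux with carefully chosen wave speeds, is used instead so as to preserve the well-balanced property. **Equilibria.** One-dimensional moving equilibria: for Euler, specific entropy (equivalently $K$), $\rho u$ and $\varepsilon$ constant; for Ripa, $hu$, $E$ and $\theta$ constant. Two-dimensional hydrostatic equilibria: for Euler, the isentropic state $\boldsymbol u=0$ with specific entropy (equivalently $K$) and $\frac{\gamma}{\gamma-1}\frac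 p\rho+\phi$ constant; for Ripa, the still water state $u=v=0$ with $\theta$ and $h+b$ constant. In these states $\boldsymbol V$ is constant. Equilibria in which stationary shocks separate smooth equilibrium regions are also covered when all the shocks are located at cell boundaries, using the Roe or HLLC flux, which resolves the stationary shock exactly. *)

(* Defs.v *)
(* MathComp / MathComp-Analysis, over an arbitrary R : realType. *)
From HB Require Import structures.
From mathcomp Require Import all_boot all_order all_algebra.
From mathcomp Require Import all_classical all_reals all_analysis.

Set Implicit Arguments.
Unset Strict Implicit.
Unset Printing Implicit Defensive.

Import Order.TTheory GRing.Theory Num.Theory numFieldNormedType.Exports.
Local Open Scope classical_set_scope.
Local Open Scope ring_scope.

Section Vectors.
Context {R : realType}.

(* The Euclidean dot product: the norm `|x| of MathComp-Analysis on row
   vectors is the sup norm. *)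
Definition dot (n : nat) (u v : 'rV[R]_n) : R := \sum_i u 0 i * v 0 i.

Definition frobenius (m n : nat) (A B : 'M[R]_(m, n)) : R :=
  \sum_i \sum_j A i j * B i j.

Definition grad (d : nat) (f : 'rV[R]_d -> R) (x : 'rV[R]_d) : 'rV[R]_d :=
  \row_i 'D_(delta_mx 0 i) f x.

(* Row i of the gradient of a vector field is its i-th partial derivative;
   fluxes follow the same layout, so that F(U).n is n *m F U. *)
Definition gradv (d n : nat) (f : 'rV[R]_d -> 'rV[R]_n) (x : 'rV[R]_d)
  : 'M[R]_(d, n) := \matrix_(i, j) 'D_(delta_mx 0 i) (fun y => f y 0 j) x.

End Vectors.

(* The d + 2 components of U and of V: a scalar, the momentum (discharge)
   vector, a scalar. *)
Notation state R d := 'rV[R]_(1 + d + 1).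

Section States.
Context {R : realType} {d : nat}.
Definition mk_state (a : R) (m : 'rV[R]_d) (c : R) : state R d :=
  row_mx (row_mx a%:M m) c%:M.
Definition cfst (U : state R d) : R := lsubmx (lsubmx U) 0 0.
Definition cmid (U : state R d) : 'rV[R]_d := rsubmx (lsubmx U).
Definition clst (U : state R d) : R := rsubmx U 0 0.
End States.

(* A system U_t + div F(U) = r(U, w) together with its equilibrium variables.
   - [number U] is the Mach (Froude) number of U;
   - [consvar M V w] is U(V, w) in the regime of Mach (Froude) number M;
   - [rest U w] is the pair of quantities which, with zero velocity, are
     constant in a hydrostatic (still water) equilibrium;
   - [star_last U q S SM] is the last component, per unit of the first one, of
     the intermediate state of the HLLC solver next to U, where q is the normal
     velocity of U, S its outer wave speed and SM the contact speed. *)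
Record system (R : realType) (d : nat) := System {
  adm : state R d -> Prop;
  flux : state R d -> 'M[R]_(d, 1 + d + 1);
  source : state R d -> 'rV[R]_d -> state R d;
  eqvar : state R d -> R -> state R d;
  number : state R d -> R;
  consvar : R -> state R d -> R -> state R d;
  rest : state R d -> R -> R * R;
  pressure : state R d -> R;
  star_last : state R d -> R -> R -> R -> R }.

Section Euler.
Context {R : realType}.
Variables (gamma : R) (d : nat).
Implicit Types (U V : state R d) (M phi rho : R).

Definition euler_pressure U : R :=
  (gamma - 1) * (clst U - 2^-1 * cfst U
     * dot ((cfst U)^-1 *: cmid U) ((cfst U)^-1 *: cmid U)).

Definition euler_adm U := 0 < cfst U /\ 0 < euler_pressure U.

Definition euler_flux U : 'M[R]_(d, 1 + d + 1) :=
  let m := cmid U in let p := euler_pressure U in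
  row_mx (row_mx m^T ((cfst U)^-1 *: (m^T *m m) + p%:M))
         (((clst U + p) / cfst U) *: m^T).

Definition euler_source U (gphi : 'rV[R]_d) : state R d :=
  mk_state 0 (- cfst U *: gphi) (- dot (cmid U) gphi).

Definition euler_K U : R := euler_pressure U / cfst U `^ gamma.

Definition euler_eqvar U phi : state R d :=
  mk_state (euler_K U) (cmid U)
    (dot (cmid U) (cmid U) / (2 * cfst U ^+ 2)
     + gamma / (gamma - 1) * (euler_pressure U / cfst U) + phi).

Definition euler_mach U : R :=
  Num.sqrt (dot ((cfst U)^-1 *: cmid U) ((cfst U)^-1 *: cmid U))
  / Num.sqrt (gamma * euler_K U * cfst U `^ (gamma - 1)).

(* The inequalities with rho_star are not strict: U(V, w-star) may be sonic when
   U(V, w) is not, and the two branches meet at the sonic point. *)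
Definition euler_root M V phi rho : Prop :=
  let K := cfst V in let q2 := dot (cmid V) (cmid V) in
  let rho_star := (q2 / (gamma * K)) `^ (gamma + 1)^-1 in
  [/\ 0 < rho,
      q2 / (2 * rho ^+ 2) + gamma / (gamma - 1) * K * rho `^ (gamma - 1)
        + phi - clst V = 0,
      (M <= 1 -> rho_star <= rho) &
      (1 <= M -> rho <= rho_star)].

Definition euler_density M V phi : R :=
  if cmid V == 0
  then ((gamma - 1) / (cfst V * gamma) * (clst V - phi)) `^ (gamma - 1)^-1
  else xget 0 [set rho | euler_root M V phi rho].

Definition euler_consvar M V phi : state R d :=
  let rho := euler_density M V phi in
  mk_state rho (cmid V)
    (dot (cmid V) (cmid V) / (2 * rho)
     + (gamma - 1)^-1 * cfst V * rho `^ gamma).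

Definition euler_rest U phi : R * R :=
  (euler_K U, gamma / (gamma - 1) * (euler_pressure U / cfst U) + phi).

Definition euler_star_last U (q S SM : R) : R :=
  clst U / cfst U
  + (SM - q) * (SM + euler_pressure U / (cfst U * (S - q))).

Definition euler : system R d :=
  System euler_adm euler_flux euler_source euler_eqvar euler_mach euler_consvar
    euler_rest euler_pressure euler_star_last.

End Euler.

Section Ripa.
Context {R : realType}.
Variables (g : R) (d : nat).
Implicit Types (U V : state R d) (M b h : R).

Definition ripa_theta U : R := clst U / cfst U.

Definition ripa_adm U := 0 < cfst U /\ 0 < ripa_theta U.

Definition ripa_pressure U : R := 2^-1 * g * cfst U ^+ 2 * ripa_theta U.

Definition ripa_flux U : 'M[R]_(d, 1 + d + 1) :=
  let m := cmid U in
  row_mx (row_mx m^T ((cfst U)^-1 *: (m^T *m m) + (ripa_pressure U)%:M))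
         (ripa_theta U *: m^T).

Definition ripa_source U (gb : 'rV[R]_d) : state R d :=
  mk_state 0 (- (g * cfst U * ripa_theta U) *: gb) 0.

Definition ripa_eqvar U b : state R d :=
  mk_state (dot (cmid U) (cmid U) / (2 * cfst U ^+ 2)
            + g * ripa_theta U * (cfst U + b))
    (cmid U) (ripa_theta U).

Definition ripa_froude U : R :=
  Num.sqrt (dot ((cfst U)^-1 *: cmid U) ((cfst U)^-1 *: cmid U))
  / Num.sqrt (g * cfst U * ripa_theta U).

Definition ripa_cubic V b h : Prop :=
  g * clst V * h ^+ 3 - (cfst V - g * b * clst V) * h ^+ 2
    + 2^-1 * dot (cmid V) (cmid V) = 0.

Definition ripa_root M V b h : Prop :=
  [/\ 0 < h, ripa_cubic V b h,
      (M <= 1 -> forall h', 0 < h' -> ripa_cubic V b h' -> h' <= h) &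
      (1 <= M -> forall h', 0 < h' -> ripa_cubic V b h' -> h <= h')].

Definition ripa_height M V b : R :=
  if cmid V == 0 then cfst V / (g * clst V) - b
  else xget 0 [set h | ripa_root M V b h].

Definition ripa_consvar M V b : state R d :=
  let h := ripa_height M V b in mk_state h (cmid V) (h * clst V).

Definition ripa_rest U b : R * R := (ripa_theta U, cfst U + b).

Definition ripa_star_last U (q S SM : R) : R := ripa_theta U.

Definition ripa : system R d :=
  System ripa_adm ripa_flux ripa_source ripa_eqvar ripa_froude ripa_consvar
    ripa_rest ripa_pressure ripa_star_last.

End Ripa.

Section Meshes.
Context {R : realType} {d : nat}.

Record box := Box { lo : 'rV[R]_d; hi : 'rV[R]_d }.

(* Cells are open boxes: fields are two-valued on the cell boundaries, which
   are negligible. *)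
Definition interior_box (T : box) : set 'rV[R]_d :=
  [set x | forall i, lo T 0 i < x 0 i < hi T 0 i].

Definition closed_box (T : box) : set 'rV[R]_d :=
  [set x | forall i, lo T 0 i <= x 0 i <= hi T 0 i].

(* Omega is the union of the selected cells of a rectangular grid. *)
Record mesh := Mesh {
  node : 'I_d -> nat -> R;
  node_lt : forall i j, node i j < node i j.+1;
  cells : seq {ffun 'I_d -> nat} }.

Definition cell_box (K : mesh) (j : {ffun 'I_d -> nat}) : box :=
  Box (\row_i node K i (j i)) (\row_i node K i (j i).+1).

Definition is_cell (K : mesh) (T : box) : Prop :=
  exists2 j, j \in cells K & T = cell_box K j.

Definition face_coord (T : box) (i : 'I_d) (up : bool) : R :=
  if up then hi T 0 i else lo T 0 i.

Definition face_normal (i : 'I_d) (up : bool) : 'rV[R]_d :=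
  if up then delta_mx 0 i else - delta_mx 0 i.

Definition on_face (T : box) (i : 'I_d) (up : bool) (x : 'rV[R]_d) : Prop :=
  x 0 i = face_coord T i up /\
  forall l, l != i -> lo T 0 l < x 0 l < hi T 0 l.

Definition trace_int (X : ptopologicalType) (f : 'rV[R]_d -> X)
  (x n : 'rV[R]_d) : X := lim (f (x - e *: n) @[e --> (0 : R)^'+]).

Definition trace_ext (X : ptopologicalType) (f : 'rV[R]_d -> X)
  (x n : 'rV[R]_d) : X := lim (f (x + e *: n) @[e --> (0 : R)^'+]).

Definition polynomial_upto (k : nat) (p : 'rV[R]_d -> R) : Prop :=
  exists c : {ffun 'I_d -> 'I_k.+1} -> R, forall x,
    p x = \sum_(a : {ffun 'I_d -> 'I_k.+1} | (\sum_i a i <= k)%N)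
            c a * \prod_i x 0 i ^+ a i.

Definition W_h (K : mesh) (k : nat) (w : 'rV[R]_d -> R) : Prop :=
  forall T, is_cell K T -> exists2 p, polynomial_upto k p &
    {in interior_box T, w =1 p}.

Definition V_h (K : mesh) (k : nat) (V : 'rV[R]_d -> state R d) : Prop :=
  forall j, W_h K k (fun x => V x 0 j).

Definition C1 (f : 'rV[R]_d -> R) : Prop :=
  [/\ continuous f, (forall i x, derivable f x (delta_mx 0 i)) &
      forall i, continuous (fun x => 'D_(delta_mx 0 i) f x)].

(* Continuously differentiable up to the boundary of each cell; jumps across
   cell boundaries are allowed. *)
Definition piecewise_C1 (K : mesh) (w : 'rV[R]_d -> R) : Prop :=
  forall T, is_cell K T -> exists2 f, C1 f & {in interior_box T, w =1 f}.

End Meshes.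
Arguments box R d : clear implicits.
Arguments mesh R d : clear implicits.

Section Integrals.
Context {R : realType}.
Notation mu := (@lebesgue_measure R).

(* The theorem concerns d = 1 and d = 2; for other d the values below are
   not meaningful. *)
Definition cell_integral (d : nat) : box R d -> ('rV[R]_d -> R) -> R :=
  match d with
  | 1%N => fun T f => \int[mu]_(s in `]lo T 0 0, hi T 0 0[) f (const_mx s)
  | 2%N => fun T f =>
      \int[(mu \x mu)%E]_(z in `]lo T 0 0, hi T 0 0[
                               `*` `]lo T 0 1, hi T 0 1[)
         f (\row_l (if l == 0 then z.1 else z.2))
  | _ => fun _ _ => 0
  end.

(* The integrand is given the point and the outward unit normal. *)
Definition boundary_integral (d : nat)
  : box R d -> ('rV[R]_d -> 'rV[R]_d -> R) -> R :=
  match d with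
  | 1%N => fun T f =>
      \sum_(up : bool) f (const_mx (face_coord T 0 up)) (face_normal 0 up)
  | 2%N => fun T f =>
      \sum_(i < 2) \sum_(up : bool)
        \int[mu]_(s in `]lo T 0 (rev_ord i), hi T 0 (rev_ord i)[)
          f (\row_l (if l == i then face_coord T i up else s))
            (face_normal i up)
  | _ => fun _ _ => 0
  end.

End Integrals.

Section Scheme.
Context {R : realType} {d : nat}.
Variable S : system R d.
Notation point := 'rV[R]_d.
Notation st := (state R d).
Implicit Types (w M : point -> R) (V phi : point -> st) (U : st)
  (Fhat : st -> st -> point -> st).

(* The Mach (Froude) number field M determines which root defines U(V, w); at an
   interface each side uses its own trace of M. *)
Definition hr_flux Fhat w M V (x n : point) : st :=
  let w_int := trace_int w x n in
  let w_ext := trace_ext w x n in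
  let w_star := Num.max w_int w_ext in
  let V_int := trace_int V x n in
  let V_ext := trace_ext V x n in
  let M_int := trace_int M x n in
  let M_ext := trace_ext M x n in
  let U_int := consvar S M_int V_int w_int in
  let U_star_int := consvar S M_int V_int w_star in
  let U_star_ext := consvar S M_ext V_ext w_star in
  Fhat U_star_int U_star_ext n - n *m flux S U_star_int + n *m flux S U_int.

Definition rhs Fhat w M V (T : box R d) phi : R :=
  let U x := consvar S (M x) (V x) (w x) in
  cell_integral T (fun x => frobenius (flux S (U x)) (gradv phi x))
  - boundary_integral T
      (fun x n => dot (hr_flux Fhat w M V x n) (trace_int phi x n))
  + cell_integral T (fun x => dot (source S (U x) (grad w x)) (phi x)).

Definition dg_solution (K : mesh R d) (k : nat) Fhat w
  (M : R -> point -> R) (V : R -> point -> st) : Prop :=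
  forall t, V_h K k (V t) /\
    forall T phi, is_cell K T -> V_h K k phi ->
      is_derive t (1 : R)
        (fun s => cell_integral T
           (fun x => dot (consvar S (M s x) (V s x) (w x)) (phi x)))
        (rhs Fhat w (M t) (V t) T phi).

Definition consistent_flux Fhat : Prop :=
  forall U n, adm S U -> dot n n = 1 -> Fhat U U n = n *m flux S U.

Definition lax_friedrichs (alpha : point -> R) (UL UR : st) (n : point) : st :=
  2^-1 *: (n *m flux S UL + n *m flux S UR - alpha n *: (UR - UL)).

Lemma lax_friedrichs_consistent alpha : consistent_flux (lax_friedrichs alpha).
Proof.
move=> U n _ _; rewrite /lax_friedrichs subrr scaler0 subr0 scalerDr -scalerDl.
by rewrite -div1r -splitr scale1r.
Qed.

(* Roe linearizations act on row vectors from the right, as [jacobian] does;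
   [roe_abs] says that A is diagonalizable with real eigenvalues and that
   absA is |A|. *)
Definition roe_abs (A absA : 'M[R]_(1 + d + 1)) : Prop :=
  exists P l, [/\ P \in unitmx, A = invmx P *m diag_mx l *m P &
    absA = invmx P *m diag_mx (map_mx Num.norm l) *m P].

Definition roe_flux Fhat : Prop :=
  exists A absA : st -> st -> point -> 'M[R]_(1 + d + 1),
  forall UL UR n, adm S UL -> adm S UR -> dot n n = 1 ->
  [/\ roe_abs (A UL UR n) (absA UL UR n),
      (UR - UL) *m A UL UR n = n *m flux S UR - n *m flux S UL,
      A UL UL n = jacobian (fun U => n *m flux S U) UL &
      Fhat UL UR n = 2^-1 *: (n *m flux S UL + n *m flux S UR
                              - (UR - UL) *m absA UL UR n)].

(* Stationary shocks: the Rankine-Hugoniot relation with zero shock speed and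
   the Lax entropy condition (the flow crosses the shock from supersonic to
   subsonic).  A left shock belongs to the acoustic wave u.n - c, a right one
   to u.n + c. *)
Definition left_shock (n : point) (UL UR : st) : Prop :=
  [/\ n *m flux S UL = n *m flux S UR, 0 < dot (cmid UL) n,
      1 < number S UL & number S UR < 1].

Definition right_shock (n : point) (UL UR : st) : Prop :=
  [/\ n *m flux S UL = n *m flux S UR, dot (cmid UR) n < 0,
      1 < number S UR & number S UL < 1].

Definition stationary_shock (n : point) (UL UR : st) : Prop :=
  left_shock n UL UR \/ right_shock n UL UR.

Definition normal_velocity (U : st) (n : point) : R := dot (cmid U) n / cfst U.

Definition hllc_star (U : st) (s sM : R) (n : point) : st :=
  let q := normal_velocity U n in
  (cfst U * ((s - q) / (s - sM))) *:
    mk_state 1 ((cfst U)^-1 *: cmid U + (sM - q) *: n) (star_last S U q s sM).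

(* The wave speeds are chosen so that the wave carrying an isolated stationary
   shock gets the exact speed 0 of that shock. *)
Definition hllc_flux Fhat : Prop :=
  exists sL sM sR : st -> st -> point -> R,
  forall UL UR n, adm S UL -> adm S UR -> dot n n = 1 ->
  let qL := normal_velocity UL n in let qR := normal_velocity UR n in
  let aL := sL UL UR n in let aM := sM UL UR n in let aR := sR UL UR n in
  [/\ aL < aM < aR,
      aM = (pressure S UR - pressure S UL + cfst UL * qL * (aL - qL)
            - cfst UR * qR * (aR - qR))
           / (cfst UL * (aL - qL) - cfst UR * (aR - qR)),
      (left_shock n UL UR -> aL = 0),
      (right_shock n UL UR -> aR = 0) &
      Fhat UL UR n =
        if 0 <= aL then n *m flux S UL
        else if 0 <= aM then n *m flux S UL + aL *: (hllc_star UL aL aM n - UL)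
        else if 0 <= aR then n *m flux S UR + aR *: (hllc_star UR aR aM n - UR)
        else n *m flux S UR].

End Scheme.

Section Equilibria.
Context {R : realType} {d : nat}.
Variables (S : system R d) (K : mesh R d).
Notation point := 'rV[R]_d.
Notation st := (state R d).
Implicit Types (w : point -> R) (Uini : point -> st).

Definition regular_in_cell (T : box R d) Uini : Prop :=
  exists2 Ub : point -> st, {in interior_box T, Uini =1 Ub} &
    {within closed_box T, continuous Ub} /\
    forall x, closed_box T x -> adm S (Ub x).

(* On the part of a cell boundary that lies on the boundary of Omega, the
   exterior traces are the boundary data. *)
Definition regular_exterior w Uini (x n : point) : Prop :=
  [/\ cvg (Uini (x + e *: n) @[e --> (0 : R)^'+]),
      cvg (w (x + e *: n) @[e --> (0 : R)^'+]) & adm S (trace_ext Uini x n)].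

Definition same_regime (a b : R) : Prop :=
  (a <= 1 /\ b <= 1) \/ (1 <= a /\ 1 <= b).

(* If w is continuous at x, this says that the state is; if w jumps at x, that
   it stays on the same branch of the same equilibrium. *)
Definition smooth_at w Uini (x n : point) : Prop :=
  eqvar S (trace_int Uini x n) (trace_int w x n)
    = eqvar S (trace_ext Uini x n) (trace_ext w x n) /\
  same_regime (number S (trace_int Uini x n)) (number S (trace_ext Uini x n)).

Definition shock_at w Uini (x n : point) : Prop :=
  trace_int w x n = trace_ext w x n /\
  stationary_shock S n (trace_int Uini x n) (trace_ext Uini x n).

(* Piecewise moving equilibria, with the interfaces subject to [link]. *)
Definition moving_with (link : point -> point -> Prop) w Uini : Prop :=
  forall T, is_cell K T ->
  [/\ regular_in_cell T Uini,
      (exists v, forall x, interior_box T x -> eqvar S (Uini x) (w x) = v) &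
      forall i up x, on_face T i up x ->
        regular_exterior w Uini x (face_normal i up) /\
        link x (face_normal i up)].

Definition moving_equilibrium w Uini : Prop := moving_with (smooth_at w Uini) w Uini.

Definition moving_equilibrium_with_shocks w Uini : Prop :=
  moving_with (fun x n => smooth_at w Uini x n \/ shock_at w Uini x n) w Uini.

Definition hydrostatic_equilibrium w Uini : Prop :=
  exists c : R * R, forall T, is_cell K T ->
  [/\ regular_in_cell T Uini,
      (forall x, interior_box T x ->
         cmid (Uini x) = 0 /\ rest S (Uini x) (w x) = c) &
      forall i up x, on_face T i up x ->
        let n := face_normal i up in
        [/\ regular_exterior w Uini x n, cmid (trace_ext Uini x n) = 0 &
            rest S (trace_ext Uini x n) (trace_ext w x n) = c]].

(* The initial values are V = V(Uini, w), in the regime given by Uini. *)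
Definition exact_for (k : nat) (Fhat : st -> st -> point -> st) w Uini : Prop :=
  let V0 x := eqvar S (Uini x) (w x) in
  let M0 x := number S (Uini x) in
  [/\ V_h K k V0,
      (forall T phi, is_cell K T -> V_h K k phi ->
         rhs S Fhat w M0 V0 T phi = 0) &
      dg_solution S K k Fhat w (fun=> M0) (fun=> V0)].

End Equilibria.

(* Main.v *)
(* In an equilibrium V is constant in each cell, and U(V, w) recovers the initial
   state because the energy r |-> q / (2 r^2) + a / (a - 1) K r^(a - 1) is strictly
   monotone on each side of the sonic density.  At a smooth interface the state on
   the side with the larger w lies on the branch selected by either side, so the
   two reconstructed states coincide; a stationary shock is resolved exactly by
   the Roe and HLLC fluxes.  In both cases the numerical flux reduces to
   n . F(U^int).  The right-hand side then vanishes by the divergence theorem on a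
   box and the pointwise balance div F(U) = r(U, w).  That balance needs care:
   U is merely continuous at a sonic point, yet F(U) is differentiable there,
   because the thrust q / r + K r^a has differential r dE on each branch, with E
   the energy above. *)
Require Import Defs.
From mathcomp Require Import all_boot all_order all_algebra.
From mathcomp Require Import all_classical all_reals all_analysis.
From mathcomp Require Import ring lra.
Import Order.TTheory GRing.Theory Num.Theory.
Local Open Scope ring_scope.
Set Implicit Arguments.
Unset Strict Implicit.
Import numFieldNormedType.Exports.
Local Open Scope classical_set_scope.

(** * Boxes and traces *)

Section Topology.
Context {R : realType}.

(** A root defining [U(V, w)] could a priori fail to exist at the reconstructed potential. Here the
    larger of the two potentials belongs to one of the two sides, and the actual state on that side
    is already a root, so only uniqueness on the branch has to be shown. When the other side is
    sonic, [same_regime] leaves both branches open; the energy inequality coming from the order of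
    the potentials then forces both densities to be sonic.

    Nothing is assumed about differentiability of the states. Each cell carries only a continuous
    admissible extension up to its closed box, and the fluxes are differentiated one direction at a
    time. Moving equilibria are confined to one dimension because constancy of [V] alone does not
    balance the momentum equation in the plane: the divergence of [m^T m / rho] points along [m],
    whereas [grad p + rho grad phi] is parallel to the gradient of [rho]. *)

Lemma cvg_mxP {T : Type} {F : set_system T} {FF : Filter F} (m n : nat)
    (f : T -> 'M[R]_(m, n)) (M : 'M[R]_(m, n)) :
  f @ F --> M <-> forall i j, f t i j @[t --> F] --> M i j.
Proof.
split=> [fM i j|fM].
  exact: (cvg_comp f (fun N : 'M[R]_(m, n) => N i j) fM (@coord_continuous R m n i j M)).
move=> A [P MP PA].
have : \forall t \near F, forall ij : 'I_m * 'I_n, P ij.1 ij.2 (f t ij.1 ij.2).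
  by apply: filter_forall => -[i j]; exact: fM (MP i j).
by apply: filterS => t Pt; apply: PA => i j; exact: (Pt (i, j)).
Qed.

Lemma near_at_right0 (P : R -> Prop) (e : R) : 0 < e ->
  (forall t, 0 < t < e -> P t) -> \forall t \near 0^'+, P t.
Proof.
move=> e0 H; near=> t; apply: H; apply/andP; split; near: t.
  exact: nbhs_right_gt.
exact: nbhs_right_lt.
Unshelve. all: by end_near. Qed.

End Topology.

Section Boxes.
Context {R : realType} {d : nat}.
Implicit Types (T : box R d) (x n : 'rV[R]_d).

Definition proper_box T := forall i, lo T 0 i < hi T 0 i.

Lemma is_cell_proper_box K T : is_cell K T -> proper_box T.
Proof. by move=> [j _ ->] i /=; rewrite !mxE; exact: node_lt. Qed.

Lemma interior_box_open T : open (interior_box T).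
Proof.
rewrite openE => x Tx.
suff : \forall y \near x, forall i, lo T 0 i < (y : 'rV[R]_d) 0 i < hi T 0 i by [].
apply: (@filter_forall _ 'I_d
  (fun i (y : 'rV[R]_d) => lo T 0 i < y 0 i < hi T 0 i) (nbhs x)) => i.
have : \forall z \near x 0 i, lo T 0 i < z < hi T 0 i.
  have /andP[l h] := Tx i.
  by near=> z; apply/andP; split; near: z; [exact: lt_nbhsr|exact: lt_nbhsl].
by move/(@coord_continuous R 1 d 0 i x).
Unshelve. all: by end_near. Qed.

Lemma interior_boxW T : interior_box T `<=` closed_box T.
Proof. by move=> x Tx i; have /andP[/ltW -> /ltW ->] := Tx i. Qed.

Lemma face_closed T i up x : proper_box T -> on_face T i up x ->
  closed_box T x.
Proof.
move=> T0 [xi xl] j; have [->|ji] := eqVneq j i.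
  by rewrite xi /face_coord; case: up {xi}; rewrite ?lexx ?ltW//= ltW.
by have /andP[/ltW -> /ltW ->] := xl j ji.
Qed.

Lemma face_normalE (i : 'I_d) up j :
  face_normal i up 0 j = (if up then 1 else -1) * (j == i)%:R :> R.
Proof. by rewrite /face_normal; case: up; rewrite !mxE ?mul1r ?mulN1r. Qed.

Lemma near_face T i up x : proper_box T -> on_face T i up x ->
  \forall e \near (0 : R)^'+, interior_box T (x - e *: face_normal i up).
Proof.
move=> T0 [xi xl].
(* The inward step has to stay shorter than the width of the box in direction [i]; the other
   coordinates do not move. *)
apply: (@near_at_right0 _ _ (hi T 0 i - lo T 0 i)).
  by rewrite subr_gt0.
move=> e /andP[e0 eT] j; rewrite !mxE.
have [->|ji] := eqVneq j i.
  rewrite face_normalE eqxx xi /face_coord; case: up {xi} => /=; lra.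
rewrite face_normalE (negbTE ji) mulr0 mulr0 subr0; exact: xl.
Qed.

Lemma cvg_segment0 x n : (x - e *: n) @[e --> (0 : R)^'+] --> x.
Proof.
rewrite -[X in _ --> X](subr0 x) -(scale0r n).
apply: cvgB; first exact: cvg_cst.
apply: cvgZr_tmp; exact: cvg_at_right_filter.
Qed.

(** Short inward segments stay in the box, so they converge in its subspace topology; this turns
    continuity up to the boundary into one-sided limits. *)
Lemma cvg_face T i up x : proper_box T -> on_face T i up x ->
  (x - e *: face_normal i up) @[e --> (0 : R)^'+] --> within (closed_box T) (nbhs x).
Proof.
move=> T0 xf A /cvg_segment0 Ax.
suff : \forall e \near (0 : R)^'+, A (x - e *: face_normal i up) by [].
near=> e; suff /= : closed_box T (x - e *: face_normal i up).
  by near: e; exact: Ax.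
by apply: interior_boxW; near: e; exact: near_face.
Unshelve. all: by end_near. Qed.

(** The field may take any values on the boundary itself: the trace sees only interior points, where
    the field agrees with its continuous extension. *)
Lemma cvg_trace_int (X : topologicalType) T i up x (f g : 'rV[R]_d -> X) :
  proper_box T -> on_face T i up x ->
  {in interior_box T, f =1 g} -> {within closed_box T, continuous g} ->
  f (x - e *: face_normal i up) @[e --> (0 : R)^'+] --> g x.
Proof.
move=> T0 xf fg /subspace_continuousP/(_ _ (face_closed T0 xf)) gx.
have := cvg_comp (fun e => x - e *: face_normal i up) g (cvg_face T0 xf) gx.
apply: cvg_trans; apply: near_eq_cvg.
by apply: filterS (near_face T0 xf) => e Te /=; rewrite fg// inE.
Qed.

Lemma trace_intE (X : ptopologicalType) T i up x (f g : 'rV[R]_d -> X) :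
  hausdorff_space X -> proper_box T -> on_face T i up x ->
  {in interior_box T, f =1 g} -> {within closed_box T, continuous g} ->
  trace_int f x (face_normal i up) = g x.
Proof. by move=> hX T0 xf fg cg; apply/cvg_lim => //; exact: cvg_trace_int cg. Qed.

End Boxes.

Section EqIntegrals.
Context {R : realType}.

Lemma ord2_ind (P : 'I_2 -> Prop) : P 0 -> P 1 -> forall i, P i.
Proof.
move=> P0 P1 [[|[|//]] i2]; first by rewrite (_ : Ordinal _ = 0)//; exact: val_inj.
by rewrite (_ : Ordinal _ = 1)//; exact: val_inj.
Qed.

Lemma rev_ord2 (i l : 'I_2) : l != i -> l = rev_ord i.
Proof. by move: l i; do 2!apply: ord2_ind => //; move=> *; exact: val_inj. Qed.

Lemma eq_cell_integral d (T : box R d) (f g : 'rV[R]_d -> R) :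
  {in interior_box T, f =1 g} -> cell_integral T f = cell_integral T g.
Proof.
case: d T f g => [|[|[|d]]] T f g fg //=; apply: eq_Rintegral => z.
  by rewrite inE/= in_itv/= => zT; rewrite fg// inE => i; rewrite mxE ord1.
rewrite inE/= !in_itv/= => -[z1 z2]; rewrite fg// inE.
by apply: ord2_ind; rewrite mxE.
Qed.

Lemma eq_boundary_integral d (T : box R d) (f g : 'rV[R]_d -> 'rV[R]_d -> R) :
  (forall i up x, on_face T i up x ->
     f x (face_normal i up) = g x (face_normal i up)) ->
  boundary_integral T f = boundary_integral T g.
Proof.
case: d T f g => [|[|[|d]]] T f g fg //=.
  apply: eq_bigr => up _; apply: fg; split; first by rewrite mxE.
  by move=> l; rewrite !ord1.
apply: eq_bigr => i _; apply: eq_bigr => up _; apply: eq_Rintegral => s.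
rewrite inE/= in_itv/= => sT; apply: fg; split; first by rewrite mxE eqxx.
by move=> l li; rewrite mxE (negbTE li) (rev_ord2 li).
Qed.

End EqIntegrals.

(** * The divergence theorem on boxes *)

Section Measurability.
Context {R : realType}.

(* An open set of the plane is the union of the rational squares it contains. *)
Lemma continuous2_measurable (f : R * R -> R) :
  continuous f -> measurable_fun setT f.
Proof.
move=> cf.
apply: (measurability _ (measurable_realfun.RGenOpens.measurableE R)).
move=> _ [_ [a [b ->] <-]]; rewrite setTI.
set O := f @^-1` _.
have oO : open O by move/continuousP : cf; apply; exact: interval_open.
pose sq (q : rat * rat * rat) : set (R * R) :=
  `](ratr q.1.1 - ratr q.2), (ratr q.1.1 + ratr q.2)[ `*`
  `](ratr q.1.2 - ratr q.2), (ratr q.1.2 + ratr q.2)[.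
have -> : O = \bigcup_(q in [set q | sq q `<=` O]) sq q.
  apply/seteqP; split=> [z Oz|z [q qO /qO//]].
  move: (oO); rewrite openE => /(_ _ Oz)/nbhs_ballP[_/posnumP[e] eO].
  (* Points of the square around [(q1, q2)] are within [2r] of [z] in each coordinate, hence the
     bound [e / 2]. *)
  have [r re] : exists r : rat, ratr r \in `]0, e%:num / 2[%R.
    have e2 : 0 < e%:num / 2 :> R by rewrite divr_gt0.
    exact: rat_in_itvoo.
  move: re; rewrite in_itv/= => /andP[r0 re].
  have rat_near (x : R) : exists q : rat, `|x - ratr q| < ratr r.
    have /rat_in_itvoo[q] : x - ratr r < x + ratr r by lra.
    by rewrite in_itv/= => /andP[xq qx]; exists q; rewrite ltr_distl; lra.
  have [q1 zq1] := rat_near z.1; have [q2 zq2] := rat_near z.2.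
  exists (q1, q2, r); last first.
    by move: zq1 zq2; rewrite !ltr_distl /sq /= !in_itv/= => -> ->.
  move=> y; rewrite /sq /= !in_itv/= => -[].
  move: zq1 zq2; rewrite !ltr_distl => /andP[? ?] /andP[? ?] /andP[? ?] /andP[? ?].
  apply: eO; split; rewrite /ball /= ltr_distl; lra.
rewrite bigcup_mkcond; apply: countable_bigcupT_measurable => [|q].
  exact: countableP.
case: ifP => // _; apply: measurableX; exact: measurable_itv.
Qed.

End Measurability.

Section Cells.
Context {R : realType}.
Notation mu := (@lebesgue_measure R).

Definition pt2 (z : R * R) : 'rV[R]_2 := \row_l (if l == 0 then z.1 else z.2).

Lemma pt2_continuous : continuous pt2.
Proof.
move=> z; apply/cvg_mxP => i; apply: ord2_ind.
  by under [fun _ => _]eq_fun do rewrite mxE/=; rewrite mxE/=; exact: cvg_fst.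
by under [fun _ => _]eq_fun do rewrite mxE/=; rewrite mxE/=; exact: cvg_snd.
Qed.

Lemma const_mx_continuous d : continuous (fun s : R => const_mx s : 'rV[R]_d).
Proof.
move=> s; apply/cvg_mxP => i j; rewrite mxE.
by under [fun _ => _]eq_fun do rewrite mxE; exact: cvg_id.
Qed.

Lemma closed_box1 (T : box R 1) s :
  s \in `[lo T 0 0, hi T 0 0]%R -> closed_box T (const_mx s).
Proof. by rewrite in_itv/= => sT i; rewrite mxE ord1. Qed.

Lemma interior_box1 (T : box R 1) s :
  s \in `]lo T 0 0, hi T 0 0[%R -> interior_box T (const_mx s).
Proof. by rewrite in_itv/= => sT i; rewrite mxE ord1. Qed.

Lemma closed_box2 (T : box R 2) z :
  z.1 \in `[lo T 0 0, hi T 0 0]%R -> z.2 \in `[lo T 0 1, hi T 0 1]%R ->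
  closed_box T (pt2 z).
Proof. by rewrite !in_itv/= => z1 z2; apply: ord2_ind; rewrite mxE. Qed.

Lemma interior_box2 (T : box R 2) z :
  z.1 \in `]lo T 0 0, hi T 0 0[%R -> z.2 \in `]lo T 0 1, hi T 0 1[%R ->
  interior_box T (pt2 z).
Proof. by rewrite !in_itv/= => z1 z2; apply: ord2_ind; rewrite mxE. Qed.

Lemma within_comp_continuous (X Y Z : topologicalType) (A : set X) (B : set Y)
    (h : X -> Y) (f : Y -> Z) :
  continuous h -> (forall x, A x -> B (h x)) ->
  {within B, continuous f} -> {within A, continuous (f \o h)}.
Proof.
move=> ch AB /subspace_continuousP cf; apply/subspace_continuousP => x Ax.
apply: (cvg_comp h f _ (cf _ (AB _ Ax))) => P BP.
have := ch x _ BP; rewrite /= => hP.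
suff : \forall y \near x, A y -> P (h y) by [].
near=> y; move=> Ay; suff : B (h y) -> P (h y) by apply; exact: AB.
by near: y.
Unshelve. all: by end_near.
Qed.

Lemma integrable1 (T : box R 1) (f : 'rV[R]_1 -> R) :
  {within closed_box T, continuous f} ->
  mu.-integrable `]lo T 0 0, hi T 0 0[ (fun s => (f (const_mx s))%:E).
Proof.
move=> cf; apply: (@integrableS _ _ R mu `[lo T 0 0, hi T 0 0]) => //.
  exact: subset_itv_oo_cc.
apply: continuous_compact_integrable; first exact: segment_compact.
apply: (@within_comp_continuous _ _ _ _ _ (fun s : R => const_mx s : 'rV[R]_1)) cf.
  exact: const_mx_continuous.
by move=> s; exact: closed_box1.
Qed.

Definition clamp (a b t : R) := Num.max a (Num.min t b).

Lemma clamp_itv a b t : a <= b -> clamp a b t \in `[a, b]%R.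
Proof. by move=> ab; rewrite in_itv/= /clamp le_max lexx/= ge_max ab ge_min lexx orbT. Qed.

Lemma clamp_id a b t : t \in `[a, b]%R -> clamp a b t = t.
Proof.
by rewrite in_itv/= => /andP[at_ tb]; rewrite /clamp (min_idPl tb) (max_idPr at_).
Qed.

Lemma clamp_continuous a b : continuous (clamp a b).
Proof.
move=> t; apply: (@continuous_max _ _ (cst a) (fun t => Num.min t b)).
  exact: cst_continuous.
by apply: (@continuous_min _ _ id (cst b)) => //; exact: cst_continuous.
Qed.

(** Composition with the coordinatewise [clamp], a retraction onto the closed box, extends [f] to
    the whole plane, where continuity yields measurability. *)
Lemma within_closed_box2_extend (T : box R 2) (f : 'rV[R]_2 -> R) :
  proper_box T -> {within closed_box T, continuous f} ->
  exists2 g : R * R -> R, continuous g &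
    forall z, closed_box T (pt2 z) -> g z = f (pt2 z).
Proof.
move=> T0 cf.
pose h (z : R * R) := pt2 (clamp (lo T 0 0) (hi T 0 0) z.1, clamp (lo T 0 1) (hi T 0 1) z.2).
exists (f \o h); last first.
  move=> z Tz; have := Tz 0; have := Tz 1; rewrite !mxE/= /h => z1 z2.
  by rewrite !clamp_id ?in_itv//; case: z {Tz z1 z2}.
apply/continuous_subspace_setT.
apply: within_comp_continuous cf => [z|z _]; last first.
  by apply: closed_box2; apply: clamp_itv; exact/ltW/T0.
apply: continuous_comp; last exact: pt2_continuous.
apply: (@cvg_pair _ _ _ (nbhs z) (nbhs (clamp _ _ z.1)) (nbhs (clamp _ _ z.2))).
  by apply: continuous_comp; [exact: cvg_fst|exact: clamp_continuous].
by apply: continuous_comp; [exact: cvg_snd|exact: clamp_continuous].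
Qed.

(** A bounded measurable function on a set of finite measure: the continuous extension gives
    measurability, and compactness of the closed rectangle gives the bound. *)
Lemma integrable2 (T : box R 2) (f : 'rV[R]_2 -> R) :
  proper_box T -> {within closed_box T, continuous f} ->
  (mu \x mu)%E.-integrable (`]lo T 0 0, hi T 0 0[ `*` `]lo T 0 1, hi T 0 1[)
    (fun z => (f (pt2 z))%:E).
Proof.
move=> T0 cf; have [g cg gf] := within_closed_box2_extend T0 cf.
have mB : measurable (`]lo T 0 0, hi T 0 0[ `*` `]lo T 0 1, hi T 0 1[ : set (R * R)).
  by apply: measurableX; exact: measurable_itv.
apply: (@eq_integrable _ _ _ (mu \x mu)%E _ mB (EFin \o g)).
  move=> z; rewrite inE /= => -[z1 z2]; rewrite gf//.
  exact/interior_boxW/interior_box2.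
apply: measurable_bounded_integrable => //.
- pose A : set R := `]lo T 0 0, hi T 0 0[; pose B : set R := `]lo T 0 1, hi T 0 1[.
  have muB : (mu \x mu)%E (A `*` B) = (mu A * mu B)%E.
    by apply: product_measure1E; exact: measurable_itv.
  apply: (@eq_ind_r _ _ (fun y => (y < +oo)%E) _ _ muB).
  by rewrite !lebesgue_measure_itv/= !lte_fin !T0 -!EFinB -EFinM ltry.
- by apply: measurable_funTS; exact: continuous2_measurable.
- have cpt : compact (`[lo T 0 0, hi T 0 0] `*` `[lo T 0 1, hi T 0 1] : set (R * R)).
    by apply: compact_setX; exact: segment_compact.
  have /compact_bounded[M [_ mrt]] := continuous_compact (continuous_subspaceT cg) cpt.
  exists M; split; rewrite ?num_real // => r Mr z [z1 z2]; apply: mrt => //.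
  by exists z => //; split; exact: subset_itv_oo_cc.
Qed.

Lemma cell_integralD d (T : box R d) (f g : 'rV[R]_d -> R) :
  proper_box T ->
  {within closed_box T, continuous f} -> {within closed_box T, continuous g} ->
  cell_integral T (fun x => f x + g x) = cell_integral T f + cell_integral T g.
Proof.
case: d T f g => [|[|[|d]]] T f g T0 cf cg /=; rewrite ?addr0//.
  by apply: RintegralD => //; exact: integrable1.
apply: RintegralD => //; [|exact: integrable2..].
by apply: measurableX; exact: measurable_itv.
Qed.

End Cells.

Section Divergence.
Context {R : realType}.
Notation mu := (@lebesgue_measure R).

(** [line] is affine with direction [v], so the two difference quotients are the same function of
    [h]. *)
Lemma is_derive_line d (f : 'rV[R]_d -> R) (line : R -> 'rV[R]_d) v s df :
  (forall h t, line (h + t) = h *: v + line t) ->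
  is_derive (line s) v f df -> is_derive s 1 (f \o line) df.
Proof.
move=> lv [fv <-].
have E : (fun h => h^-1 *: ((f \o line) (h *: 1 + s) - (f \o line) s)) =
         (fun h => h^-1 *: (f (h *: v + line s) - f (line s))).
  by apply/funext => h /=; rewrite -lv /GRing.scale/= mulr1.
by apply: DeriveDef; rewrite /derivable /derive E.
Qed.

Lemma Rintegral_derive (F f : R -> R) (a b : R) : a < b ->
  {within `[a, b], continuous F} -> {within `[a, b], continuous f} ->
  (forall s, s \in `]a, b[%R -> is_derive s 1 F (f s)) ->
  \int[mu]_(s in `]a, b[) f s = F b - F a.
Proof.
move=> ab cF cf dF.
have fi : mu.-integrable `[a, b] (EFin \o f).
  by apply: continuous_compact_integrable => //; exact: segment_compact.
rewrite Rintegral_itv_obnd_cbnd; last first.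
  by apply: integrableS fi => //; exact: subset_itv_oo_cc.
rewrite Rintegral_itv_bndo_bndc; last first.
  by apply: integrableS fi => //; apply: subset_itvl; rewrite bnd_simp.
rewrite /Rintegral (continuous_FTC2 ab cf (F := F))//.
- by have /(continuous_within_itvP _ ab)[_ ? ?] := cF; split => // s /dF [].
- by move=> s /dF [_ <-]; rewrite derive1E.
Qed.

(** Fubini's theorem for the extension of [f] by zero outside the rectangle, which is integrable
    over the plane. *)
Lemma cell_integral21 (T : box R 2) (f : 'rV[R]_2 -> R) :
  proper_box T -> {within closed_box T, continuous f} ->
  cell_integral T f = \int[mu]_(y in `]lo T 0 1, hi T 0 1[)
    \int[mu]_(x in `]lo T 0 0, hi T 0 0[) f (pt2 (x, y)).
Proof.
move=> T0 cf; rewrite /= /Rintegral; congr fine.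
pose A : set R := `]lo T 0 0, hi T 0 0[; pose B : set R := `]lo T 0 1, hi T 0 1[.
have mA : measurable A by exact: measurable_itv.
have mB : measurable B by exact: measurable_itv.
have fi := integrable2 T0 cf.
have mAB : measurable (A `*` B) by apply: measurableX.
pose h z := (f (pt2 z))%:E.
rewrite integral_mkcond
  -[LHS](@integral21_prod_meas1 _ _ _ _ _ mu mu (h \_ (A `*` B))); last first.
  by apply/(integrable_restrict (mu \x mu)%E mAB measurableT); rewrite setTI.
rewrite [RHS]integral_mkcond; apply: eq_integral => y _.
rewrite /fubini_G !patchE; case: ifPn => [|]; rewrite (inE, notin_setE) => yB.
  (* The inner real-valued integral is the [fine] of an extended one, so it must be shown finite;
     continuity of the slice on a segment ensures this. *)
  rewrite fineK; last first.
    apply: integrable_fin_num => //.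
    apply: (@integrableS _ _ R mu `[lo T 0 0, hi T 0 0]) => //; first exact: subset_itv_oo_cc.
    apply: continuous_compact_integrable; first exact: segment_compact.
    apply: (@within_comp_continuous _ _ _ _ _ (fun x : R => pt2 (x, y))) cf => [x|x xT].
      apply: continuous_comp; last exact: pt2_continuous.
      by apply: (@cvg_pair _ _ _ _ (nbhs x) (nbhs y)); [exact: cvg_id|exact: cvg_cst].
    apply: closed_box2 => //; exact: subset_itv_oo_cc.
  rewrite [RHS]integral_mkcond; apply: eq_integral => x _.
  rewrite !patchE; congr (if _ then _ else _).
  by apply/idP/idP; rewrite !inE => //= -[].
rewrite integral0_eq// => x _; rewrite patchE ifF//.
by apply/negP; rewrite inE => -[].
Qed.

Lemma cell_integral12 (T : box R 2) (f : 'rV[R]_2 -> R) :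
  proper_box T -> {within closed_box T, continuous f} ->
  cell_integral T f = \int[mu]_(x in `]lo T 0 0, hi T 0 0[)
    \int[mu]_(y in `]lo T 0 1, hi T 0 1[) f (pt2 (x, y)).
Proof.
move=> T0 cf; rewrite /= /Rintegral; congr fine.
pose A : set R := `]lo T 0 0, hi T 0 0[; pose B : set R := `]lo T 0 1, hi T 0 1[.
have mA : measurable A by exact: measurable_itv.
have mB : measurable B by exact: measurable_itv.
have fi := integrable2 T0 cf.
have mAB : measurable (A `*` B) by apply: measurableX.
pose h z := (f (pt2 z))%:E.
rewrite integral_mkcond
  -[LHS](@integral12_prod_meas1 _ _ _ _ _ mu mu (h \_ (A `*` B))); last first.
  by apply/(integrable_restrict (mu \x mu)%E mAB measurableT); rewrite setTI.
rewrite [RHS]integral_mkcond; apply: eq_integral => x _.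
rewrite /fubini_F !patchE; case: ifPn => [|]; rewrite (inE, notin_setE) => xA.
  rewrite fineK; last first.
    apply: integrable_fin_num => //.
    apply: (@integrableS _ _ R mu `[lo T 0 1, hi T 0 1]) => //; first exact: subset_itv_oo_cc.
    apply: continuous_compact_integrable; first exact: segment_compact.
    apply: (@within_comp_continuous _ _ _ _ _ (fun y : R => pt2 (x, y))) cf => [y|y yT].
      apply: continuous_comp; last exact: pt2_continuous.
      by apply: (@cvg_pair _ _ _ _ (nbhs x) (nbhs y)); [exact: cvg_cst|exact: cvg_id].
    apply: closed_box2 => //; exact: subset_itv_oo_cc.
  rewrite [RHS]integral_mkcond; apply: eq_integral => y _.
  rewrite !patchE; congr (if _ then _ else _).
  by apply/idP/idP; rewrite !inE => //= -[].
rewrite integral0_eq// => y _; rewrite patchE ifF//.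
by apply/negP; rewrite inE => -[].
Qed.

Lemma sum_face_normal d (i : 'I_d) up (a : 'I_d -> R) :
  \sum_l face_normal i up 0 l * a l = (if up then 1 else -1) * a i.
Proof.
rewrite (bigD1 i)//= big1 ?addr0 => [|l li]; rewrite face_normalE.
  by rewrite eqxx mulr1.
by rewrite (negbTE li) mulr0 mul0r.
Qed.

Lemma row2_continuous (i : 'I_2) (c : R) :
  continuous (fun s : R => \row_l (if l == i then c else s) : 'rV[R]_2).
Proof.
move=> s; apply/cvg_mxP => k l; rewrite mxE.
under [fun _ => _]eq_fun do rewrite mxE.
by case: ifP => _; [exact: cvg_cst|exact: cvg_id].
Qed.

Lemma row2_continuousl (i : 'I_2) (c : R) :
  continuous (fun s : R => \row_l (if l == i then s else c) : 'rV[R]_2).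
Proof.
move=> s; apply/cvg_mxP => k l; rewrite mxE.
under [fun _ => _]eq_fun do rewrite mxE.
by case: ifP => _; [exact: cvg_id|exact: cvg_cst].
Qed.

Lemma closed_box_row2 (T : box R 2) i s t :
  s \in `[lo T 0 (rev_ord i), hi T 0 (rev_ord i)]%R ->
  t \in `[lo T 0 i, hi T 0 i]%R -> closed_box T (\row_l (if l == i then t else s)).
Proof.
rewrite !in_itv/= => sT tT l; rewrite mxE; case: eqVneq => [->//|li].
by rewrite (rev_ord2 li).
Qed.

Lemma interior_box_row2 (T : box R 2) i s t :
  s \in `]lo T 0 (rev_ord i), hi T 0 (rev_ord i)[%R ->
  t \in `]lo T 0 i, hi T 0 i[%R -> interior_box T (\row_l (if l == i then t else s)).
Proof.
rewrite !in_itv/= => sT tT l; rewrite mxE; case: eqVneq => [->//|li].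
by rewrite (rev_ord2 li).
Qed.

Lemma integrable_face2 (T : box R 2) (f : 'rV[R]_2 -> R) (i : 'I_2) c :
  c \in `[lo T 0 i, hi T 0 i]%R -> {within closed_box T, continuous f} ->
  mu.-integrable `]lo T 0 (rev_ord i), hi T 0 (rev_ord i)[
    (fun s => (f (\row_l (if l == i then c else s)))%:E).
Proof.
move=> cT cf.
apply: (@integrableS _ _ R mu `[lo T 0 (rev_ord i), hi T 0 (rev_ord i)]) => //.
  exact: subset_itv_oo_cc.
apply: continuous_compact_integrable; first exact: segment_compact.
apply: (@within_comp_continuous _ _ _ _ _
  (fun s : R => \row_l (if l == i then c else s)) f _ _ cf) => [|s sT].
  exact: row2_continuous.
exact: closed_box_row2.
Qed.

Lemma cell_integral_slices (T : box R 2) (f : 'rV[R]_2 -> R) (i : 'I_2) :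
  proper_box T -> {within closed_box T, continuous f} ->
  cell_integral T f =
  \int[mu]_(s in `]lo T 0 (rev_ord i), hi T 0 (rev_ord i)[)
    \int[mu]_(t in `]lo T 0 i, hi T 0 i[) f (\row_l (if l == i then t else s)).
Proof.
move=> T0 cf; move: i; apply: ord2_ind.
  rewrite (_ : rev_ord 0 = 1); last exact: val_inj.
  by rewrite cell_integral21.
rewrite (_ : rev_ord 1 = 0); last exact: val_inj.
rewrite cell_integral12//; apply: eq_Rintegral => x _; apply: eq_Rintegral => y _.
by congr f; apply/rowP; apply: ord2_ind; rewrite !mxE.
Qed.

Lemma cell_integral_derive2 (T : box R 2) (Phi D : 'rV[R]_2 -> R) (i : 'I_2) :
  proper_box T ->
  {within closed_box T, continuous Phi} -> {within closed_box T, continuous D} ->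
  (forall x, interior_box T x -> is_derive x (delta_mx 0 i) Phi (D x)) ->
  cell_integral T D =
  \int[mu]_(s in `]lo T 0 (rev_ord i), hi T 0 (rev_ord i)[)
    (Phi (\row_l (if l == i then hi T 0 i else s)) -
     Phi (\row_l (if l == i then lo T 0 i else s))).
Proof.
move=> T0 cPhi cD dPhi; rewrite (cell_integral_slices i)//.
apply: eq_Rintegral => s; rewrite inE/= => sT.
have line (f : 'rV[R]_2 -> R) : {within closed_box T, continuous f} ->
    {within `[lo T 0 i, hi T 0 i],
      continuous (fun t => f (\row_l (if l == i then t else s)))}.
  move=> cf; apply: (@within_comp_continuous _ _ _ _ _
    (fun t : R => \row_l (if l == i then t else s)) f _ _ cf).
    exact: row2_continuousl.
  by move=> t tT; apply: closed_box_row2 => //; exact: subset_itv_oo_cc.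
apply: (@Rintegral_derive (fun t => Phi (\row_l (if l == i then t else s)))).
- exact: T0.
- exact: line.
- exact: line.
- move=> t tT.
  apply: (@is_derive_line _ _ (fun t => \row_l (if l == i then t else s)) (delta_mx 0 i)).
    move=> h u; apply/rowP => l; rewrite !mxE/=.
    by case: eqVneq => _; rewrite ?mulr1 ?mulr0 ?add0r.
  by apply: dPhi; exact: interior_box_row2.
Qed.

(** Each direction is treated separately: integrating [D i] along lines of direction [i] leaves the
    values of [Phi i] on the two orthogonal faces, with the signs of the outward normals. Each
    [Phi i] is differentiated only in its own direction and only inside the box, which is all that
    is known of the fluxes of an equilibrium. *)
Theorem divergence_box d (T : box R d) (Phi D : 'I_d -> 'rV[R]_d -> R) :
  proper_box T ->
  (forall i, {within closed_box T, continuous (Phi i)}) ->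
  (forall i, {within closed_box T, continuous (D i)}) ->
  (forall i x, interior_box T x -> is_derive x (delta_mx 0 i) (Phi i) (D i x)) ->
  cell_integral T (fun x => \sum_i D i x) =
  boundary_integral T (fun x n => \sum_i n 0 i * Phi i x).
Proof.
(* In dimensions other than 1 and 2 both integrals are 0 by definition. *)
case: d T Phi D => [|[|[|d]]] T Phi D T0 cPhi cD dPhi //.
  rewrite /= big_bool !sum_face_normal mul1r mulN1r.
  under eq_Rintegral do rewrite big_ord1.
  have line (f : 'rV[R]_1 -> R) : {within closed_box T, continuous f} ->
      {within `[lo T 0 0, hi T 0 0], continuous (fun s => f (const_mx s))}.
    move=> cf; apply: (@within_comp_continuous _ _ _ _ _ (fun s : R => const_mx s) f _ _ cf).
      exact: const_mx_continuous.
    by move=> s; exact: closed_box1.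
  apply: (@Rintegral_derive (fun s => Phi 0 (const_mx s))); first exact: T0.
  - exact: line.
  - exact: line.
  - move=> s sT; apply: (@is_derive_line _ _ (fun s => const_mx s) (delta_mx 0 0)).
      by move=> h t; apply/rowP => i; rewrite !mxE ord1 eqxx mulr1.
    by apply: dPhi; exact: interior_box1.
have sum2 (F : 'I_2 -> R) : \sum_i F i = F 0 + F 1.
  by rewrite big_ord_recl big_ord1; congr (F _ + F _); exact: val_inj.
transitivity (cell_integral T (D 0) + cell_integral T (D 1)).
  rewrite -cell_integralD//; apply: eq_cell_integral => x _; exact: sum2.
rewrite -(sum2 (fun i => cell_integral T (D i))) [RHS]/=; apply: eq_bigr => i _.
rewrite (cell_integral_derive2 T0 (cPhi i) (cD i) (dPhi i)).
rewrite big_bool RintegralB//; last 2 first.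
- by apply: integrable_face2 => //; rewrite bound_itvE ltW.
- by apply: integrable_face2 => //; rewrite bound_itvE ltW.
congr (_ + _).
  by apply: eq_Rintegral => s _; rewrite sum_face_normal mul1r.
under [RHS]eq_Rintegral do rewrite sum_face_normal.
rewrite RintegralZl ?mulN1r//.
by apply: integrable_face2 => //; rewrite /face_coord bound_itvE ltW.
Qed.

End Divergence.

(** * Subsonic and supersonic branches *)

Section Branches.
Context {R : realType}.
Variables (a K q : R).
Implicit Types (r s M : R).
Hypotheses (a1 : 1 < a) (K0 : 0 < K) (q0 : 0 <= q).

(** Here [r] is a density, [q] the squared momentum, [K] the entropy constant and [a] the ratio of
    specific heats. [denergy] is the derivative of [energy]: it equals [(c^2 - u^2) / r] with
    squared sound speed [c^2 = a K r^(a - 1)] and squared velocity [u^2 = q / r^2]. [sonic] is the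
    density at which the two agree; it is 0 when [q = 0]. *)
Definition energy (r : R) : R := q / (2 * r ^+ 2) + a / (a - 1) * K * r `^ (a - 1).
Definition thrust (r : R) : R := q / r + K * r `^ a.
Definition denergy (r : R) : R := r^-1 * (a * K * r `^ (a - 1) - q / r ^+ 2).
Definition sonic : R := (q / (a * K)) `^ (a + 1)^-1.

Let a0 : 0 < a. Proof. exact: lt_trans ltr01 a1. Qed.
Let aK0 : 0 < a * K. Proof. exact: mulr_gt0. Qed.
Let a10 : 0 < a + 1. Proof. exact: addr_gt0. Qed.

Lemma sonic_ge0 : 0 <= sonic. Proof. exact: powR_ge0. Qed.

Lemma powR_le (p x y : R) : 0 < p -> 0 <= x -> 0 <= y -> (x `^ p <= y `^ p) = (x <= y).
Proof.
move=> p0 x0 y0; apply/idP/idP; last by move=> xy; apply: ge0_ler_powR => //; exact: ltW.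
by apply: contraTT; rewrite -!ltNge => yx; apply: gt0_ltr_powR.
Qed.

Let sonicX : sonic `^ (a + 1) = q / (a * K).
Proof. by rewrite /sonic -powRrM mulVf ?gt_eqF// powRr1// divr_ge0// ltW. Qed.

Let powRDX r : 0 < r -> r `^ (a + 1) = r `^ (a - 1) * r ^+ 2.
Proof.
move=> r0; rewrite (_ : a + 1 = (a - 1) + 2%:R); last by rewrite -addrA; congr (_ + _); lra.
by rewrite powRD ?powR_mulrn ?(ltW r0)// (gt_eqF r0) implybT.
Qed.

(** Raising to the power [a + 1] and dividing by [r^2] turns comparison with the sonic density into
    comparison of the squared velocity with the squared sound speed. *)
Lemma le_sonic r : 0 < r -> (sonic <= r) = (q / r ^+ 2 <= a * K * r `^ (a - 1)).
Proof.
move=> r0; rewrite -(@powR_le (a + 1)) ?sonic_ge0 ?(ltW r0)// sonicX powRDX//.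
by rewrite !ler_pdivrMr ?exprn_gt0// mulrC mulrA.
Qed.

Lemma ge_sonic r : 0 < r -> (r <= sonic) = (a * K * r `^ (a - 1) <= q / r ^+ 2).
Proof.
move=> r0; rewrite -(@powR_le (a + 1)) ?sonic_ge0 ?(ltW r0)// sonicX powRDX//.
by rewrite !ler_pdivlMr ?exprn_gt0// mulrC mulrA.
Qed.

Lemma denergy_gt0 r : 0 < r -> sonic < r -> 0 < denergy r.
Proof.
move=> r0; rewrite ltNge ge_sonic// -ltNge => sr.
by rewrite /denergy mulr_gt0 ?invr_gt0// subr_gt0.
Qed.

Lemma denergy_lt0 r : 0 < r -> r < sonic -> denergy r < 0.
Proof.
move=> r0; rewrite ltNge le_sonic// -ltNge => sr.
by rewrite /denergy pmulr_rlt0 ?invr_gt0// subr_lt0.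
Qed.

Lemma is_derive_energy r : 0 < r -> is_derive (r : R) (1 : R) energy (denergy r).
Proof.
move=> r0.
(* Every term becomes a real power, whose derivative is known; the two expressions are compared only
   at positive arguments, that is, near [r]. *)
pose f : R -> R := cst (q / 2) * (@powR R ^~ (- 2)) +
  cst (a / (a - 1) * K) * (@powR R ^~ (a - 1)).
have df b := is_derive1_powR b r0.
apply: (@near_eq_is_derive _ _ _ f).
  near=> x.
  have x0 : 0 < x by near: x; exact: lt_nbhsr.
  rewrite /f /energy !fctE /GRing.scale/= powR_invn ?ltW//; congr (_ + _).
  by rewrite -mulrA -invfM.
apply: is_derive_eq; rewrite /GRing.scale/= /denergy.
rewrite (_ : - 2 - 1 = - 3%:R); last by lra.
rewrite powR_invn ?ltW// powRB ?(gt_eqF r0) ?implybT// powRr1 ?ltW//.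
field; rewrite (gt_eqF r0)/= subr_eq0 gt_eqF//.
Unshelve. all: by end_near. Qed.

Lemma is_derive_thrust r : 0 < r -> is_derive (r : R) (1 : R) thrust (r * denergy r).
Proof.
move=> r0.
pose f : R -> R := cst q * (@powR R ^~ (- 1)) + cst K * (@powR R ^~ a).
have df b := is_derive1_powR b r0.
apply: (@near_eq_is_derive _ _ _ f).
  near=> x.
  have x0 : 0 < x by near: x; exact: lt_nbhsr.
  by rewrite /f /thrust !fctE /GRing.scale/= powR_inv1 ?ltW.
apply: is_derive_eq; rewrite /GRing.scale/= /denergy.
rewrite (_ : - 1 - 1 = - 2%:R); last by lra.
rewrite powR_invn ?ltW//; field; exact: lt0r_neq0.
Unshelve. all: by end_near. Qed.

Lemma cvg_energy r : 0 < r -> energy x @[x --> r] --> energy r.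
Proof. by move=> /is_derive_energy [/derivable1_diffP/differentiable_continuous]. Qed.

Lemma cvg_thrust r : 0 < r -> thrust x @[x --> r] --> thrust r.
Proof. by move=> /is_derive_thrust [/derivable1_diffP/differentiable_continuous]. Qed.

Let within_itv (f : R -> R) r s : 0 < r -> (forall x : R, 0 < x -> f y @[y --> x] --> f x) ->
  {within `[r, s], continuous f}.
Proof.
move=> r0 cf; apply/subspace_continuousP => x /=; rewrite in_itv/= => /andP[rx _].
by apply: cvg_within_filter; apply: cf; exact: lt_le_trans rx.
Qed.

Lemma energy_incr r s : 0 < r -> sonic <= r -> r < s -> energy r < energy s.
Proof.
move=> r0 sr rs; rewrite -subr_gt0.
have [c|c cI ->] := @MVT R energy denergy r s rs _ (within_itv r0 cvg_energy).
  by rewrite in_itv/= => /andP[rc _]; apply/is_derive_energy/(lt_trans r0).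
move: cI; rewrite in_itv/= => /andP[rc _].
rewrite mulr_gt0 ?subr_gt0// denergy_gt0//; first exact: lt_trans rc.
exact: le_lt_trans rc.
Qed.

Lemma energy_decr r s : 0 < r -> s <= sonic -> r < s -> energy s < energy r.
Proof.
move=> r0 sr rs; rewrite -subr_lt0.
have [c|c cI ->] := @MVT R energy denergy r s rs _ (within_itv r0 cvg_energy).
  by rewrite in_itv/= => /andP[rc _]; apply/is_derive_energy/(lt_trans r0).
move: cI; rewrite in_itv/= => /andP[rc cs].
rewrite pmulr_llt0 ?subr_gt0// denergy_lt0//; first exact: lt_trans rc.
exact: lt_le_trans sr.
Qed.

(** Both implications apply at [M = 1], where they force [r] to be sonic. *)
Definition on_branch (M r : R) := (M <= 1 -> sonic <= r) /\ (1 <= M -> r <= sonic).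

(** The energy increases beyond the sonic density, so a subsonic density exceeds every other one of
    equal energy, whichever branch that one lies on. *)
Lemma on_branch_max M r s : 0 < r -> on_branch M r -> M <= 1 ->
  0 < s -> energy s = energy r -> s <= r.
Proof.
move=> r0 [br _] M1 s0 E; rewrite leNgt; apply/negP => rs.
by have := energy_incr r0 (br M1) rs; rewrite E ltxx.
Qed.

Lemma on_branch_min M r s : 0 < r -> on_branch M r -> 1 <= M ->
  0 < s -> energy s = energy r -> r <= s.
Proof.
move=> r0 [_ br] M1 s0 E; rewrite leNgt; apply/negP => sr.
by have := energy_decr s0 (br M1) sr; rewrite E ltxx.
Qed.

Lemma on_branch_unique M r s : 0 < r -> 0 < s -> on_branch M r -> on_branch M s ->
  energy r = energy s -> r = s.
Proof.
move=> r0 s0 br bs E; apply/le_anti; have [M1|/ltW M1] := leP M 1.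
  by rewrite (on_branch_max s0 bs)// (on_branch_max r0 br).
by rewrite (on_branch_min s0 bs)// (on_branch_min r0 br).
Qed.

(* [s] and [M'] belong to the side of the interface with the smaller potential,
   hence the larger kinetic and internal energy. *)
Lemma on_branch_transfer M M' r s : 0 < r -> 0 < s ->
  (M <= 1) = (sonic <= r) -> (1 <= M) = (r <= sonic) ->
  (M' <= 1) = (sonic <= s) -> (1 <= M') = (s <= sonic) ->
  same_regime M M' -> energy r <= energy s -> on_branch M' r.
Proof.
move=> r0 s0 Ml Mg Ml' Mg' MM' rs; split=> M'1; case: MM' => -[M1 M'1'].
- by rewrite -Ml.
(* A sonic [s] minimizes the energy, and [r] has no more energy than [s], so [r] cannot lie strictly
   on the supersonic side. *)
- have sE : s = sonic by apply/le_anti; rewrite -Ml' -Mg' M'1 M'1'.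
  rewrite leNgt; apply/negP => sr; rewrite -sE in sr.
  by have := energy_decr r0 _ sr; rewrite sE lexx -sE ltNge rs => /(_ isT).
- have sE : s = sonic by apply/le_anti; rewrite -Ml' -Mg' M'1' M'1.
  rewrite leNgt; apply/negP => sr; rewrite -sE in sr.
  by have := energy_incr s0 _ sr; rewrite sE lexx -sE ltNge rs => /(_ isT).
- by rewrite -Mg.
Qed.

(** Cauchy's mean value theorem: the quotient of the derivatives of [thrust] and [energy] at [c] is
    [c] itself. It applies because [denergy] vanishes only at the sonic density, which is at most an
    endpoint of the interval. *)
Let thrust_mean r s : 0 < r -> r < s -> s <= sonic \/ sonic <= r ->
  exists2 c, r < c < s & thrust s - thrust r = c * (energy s - energy r).
Proof.
move=> r0 rs br.
have c0 c : c \in `]r, s[%R -> 0 < c.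
  by rewrite in_itv/= => /andP[rc _]; exact: lt_trans rc.
have dT c : c \in `]r, s[%R -> is_derive c 1 thrust (c * denergy c).
  by move=> /c0; exact: is_derive_thrust.
have dE c : c \in `]r, s[%R -> is_derive c 1 energy (denergy c).
  by move=> /c0; exact: is_derive_energy.
have dE0 c : c \in `]r, s[%R -> denergy c != 0.
  move=> cI; have := cI; rewrite in_itv/= => /andP[rc cs]; case: br => br.
    by rewrite lt_eqF// denergy_lt0 ?c0//; exact: lt_le_trans br.
  by rewrite gt_eqF// denergy_gt0 ?c0//; exact: le_lt_trans rc.
have cT := @within_itv thrust r s r0 cvg_thrust.
have cE := @within_itv energy r s r0 cvg_energy.
have E0 := differentiable_subr_neq0 rs cE dE dE0.
have [c cI] := cauchy_MVT rs cT cE dT dE dE0.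
rewrite mulfK ?dE0// => cE'; exists c; first by move: cI; rewrite in_itv.
by rewrite cE' divfK.
Qed.

(* Bernoulli's law without differentiability of the density: along an
   equilibrium branch dT = r dE even at sonic points, where dr/dx may fail to
   exist. *)
Lemma thrust_energy r s : 0 < r -> 0 < s ->
  (r <= sonic /\ s <= sonic) \/ (sonic <= r /\ sonic <= s) ->
  `|thrust s - thrust r - r * (energy s - energy r)|
    <= `|s - r| * `|energy s - energy r|.
Proof.
move=> r0 s0 br; have [rs|sr|->] := ltgtP r s; last by rewrite !subrr mulr0 subrr normr0 mul0r.
- have [|c /andP[rc cs] ->] := thrust_mean r0 rs; first by tauto.
  rewrite -mulrBl normrM ler_wpM2r// !gtr0_norm ?subr_gt0//.
  by rewrite lerD2r ltW.
- have [|c /andP[rc cs] E] := thrust_mean s0 sr; first by tauto.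
  rewrite (_ : _ - _ - _ = (c - r) * (energy s - energy r)); last by lra.
  rewrite normrM ler_wpM2r// !ltr0_norm ?subr_lt0//; lra.
Qed.

End Branches.

(** * Differentiating the thrust along an equilibrium *)

Section Bernoulli.
Context {R : realType} {d : nat}.
Variables (a K q : R).
Hypotheses (a1 : 1 < a) (K0 : 0 < K) (q0 : 0 <= q).
Implicit Types (r w : 'rV[R]_d -> R) (x v : 'rV[R]_d).
Notation energy := (energy a K q).
Notation thrust := (thrust a K q).
Notation sonic := (sonic a K q).

(** Since [energy (r y)] equals [C - w y], it is differentiable even where [r] is not. The
    difference quotient of the thrust is [r x] times that of the energy up to an error that vanishes
    by mere continuity of [r]. *)
Lemma bernoulli r w x v (w' C : R) :
  r @ x --> r x -> (\forall y \near x, 0 < r y) ->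
  (\forall y \near x, energy (r y) + w y = C) ->
  is_derive x v w w' ->
  is_derive x v (fun y => thrust (r y)) (- r x * w').
Proof.
move=> cr r_gt0 rC dw.
have rx0 : 0 < r x := nbhs_singleton r_gt0.
have [dE DE] : is_derive x v (fun y => energy (r y)) (- w').
  apply: (@near_eq_is_derive _ _ _ (cst C - w)).
    by apply: filterS rC => y <-; rewrite !fctE /= addrK.
  by apply: is_derive_eq; rewrite sub0r.
have shift : x + h *: v @[h --> (0 : R)^'] --> x.
  rewrite -[X in _ --> X](addr0 x) -(scale0r v).
  apply: cvgD; first exact: cvg_cst.
  by apply: cvgZr_tmp; apply: cvg_within_filter; exact: cvg_id.
pose dq (f : 'rV[R]_d -> R) (h : R) := h^-1 *: (f (h *: v + x) - f x).
have cE : dq (fun y => energy (r y)) h @[h --> 0^'] --> - w' by rewrite -DE.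
(* A density off the sonic value keeps its side nearby; the sonic density itself belongs to both
   sides. *)
have same_side : \forall y \near x,
    (r x <= sonic /\ r y <= sonic) \/ (sonic <= r x /\ sonic <= r y).
  have [rs|rs|rs] := ltgtP (r x) sonic.
  - have : \forall y \near x, r y < sonic by exact: (cr _ (lt_nbhsl rs)).
    by apply: filterS => y /ltW ys; left.
  - have : \forall y \near x, sonic < r y by exact: (cr _ (lt_nbhsr rs)).
    by apply: filterS => y /ltW ys; right.
  - by near=> y; case: (leP (r y) sonic) => [?|/ltW ?]; [left|right].
pose err h := dq (fun y => thrust (r y)) h - r x * dq (fun y => energy (r y)) h.
have cerr : err h @[h --> 0^'] --> 0.
  apply/norm_cvg0P.
  (* Dividing the bound of [thrust_energy] by [|h|] leaves an increment of [r], which tends to 0,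
     times a convergent quotient. *)
  apply: (@squeeze_cvgr _ _ _ _ (cst 0)
    (fun h => `|r (x + h *: v) - r x| * `|dq (fun y => energy (r y)) h|)).
  - have near_x : \forall y \near x,
        `|thrust (r y) - thrust (r x) - r x * (energy (r y) - energy (r x))|
        <= `|r y - r x| * `|energy (r y) - energy (r x)|.
      by near=> y; apply: thrust_energy => //; near: y.
    have near_0 := shift _ near_x.
    near=> h; rewrite normr_ge0/=.
    rewrite /err /dq /GRing.scale/= (addrC _ x) mulrCA -mulrBr !normrM mulrCA.
    by rewrite ler_wpM2l//; near: h.
  - exact: cvg_cst.
  - have cr0 : `|r (x + h *: v) - r x| @[h --> 0^'] --> (0 : R).
      apply/norm_cvg0P; rewrite -[X in _ --> X](subrr (r x)).
      by apply: cvgB; [exact: (cvg_comp _ r shift cr)|exact: cvg_cst].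
    have cE' : `|dq (fun y => energy (r y)) h| @[h --> 0^'] --> `|- w'|.
      exact: cvg_norm cE.
    by rewrite -[X in _ --> X](mul0r `|- w'|); exact: cvgM cr0 cE'.
have cT : dq (fun y => thrust (r y)) h @[h --> 0^'] --> - r x * w'.
  rewrite mulNr -mulrN -[X in _ --> X]addr0.
  rewrite (_ : dq _ = (fun h => r x * dq (fun y => energy (r y)) h + err h)); last first.
    by apply/funext => h; rewrite /err addrC subrK.
  by apply: cvgD => //; exact: cvgMl_tmp.
by apply: DeriveDef; [exact: cvgP cT|exact: cvg_lim cT].
Unshelve. all: by end_near. Qed.

End Bernoulli.

(** * Euler equations and Ripa model *)

Section StateVectors.
Context {R : realType} {d : nat}.
Implicit Types (U V : state R d) (m : 'rV[R]_d) (b c : R).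

Definition ifst : 'I_(1 + d + 1) := lshift 1 (lshift d 0).
Definition imid (k : 'I_d) : 'I_(1 + d + 1) := lshift 1 (rshift 1 k).
Definition ilst : 'I_(1 + d + 1) := rshift (1 + d) 0.

Lemma state_index_ind (P : 'I_(1 + d + 1) -> Prop) :
  P ifst -> (forall k, P (imid k)) -> P ilst -> forall j, P j.
Proof.
move=> P0 Pk P1 j; case: (split_ordP j) => [l ->|l ->]; last by rewrite (ord1 l).
by case: (split_ordP l) => [k ->|k ->]; [rewrite (ord1 k)|exact: Pk].
Qed.

Lemma cfstE U : cfst U = U 0 ifst. Proof. by rewrite /cfst !mxE. Qed.

Lemma cmidE U k : cmid U 0 k = U 0 (imid k). Proof. by rewrite /cmid !mxE. Qed.

Lemma clstE U : clst U = U 0 ilst. Proof. by rewrite /clst !mxE. Qed.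

Lemma mk_stateK U : mk_state (cfst U) (cmid U) (clst U) = U.
Proof.
rewrite /mk_state /cfst /cmid /clst -!mx11_scalar.
by rewrite hsubmxK hsubmxK.
Qed.

Lemma cfst_mk b m c : cfst (mk_state b m c) = b.
Proof. by rewrite /cfst /mk_state !row_mxKl mxE eqxx mulr1n. Qed.

Lemma cmid_mk b m c : cmid (mk_state b m c) = m.
Proof. by rewrite /cmid /mk_state row_mxKl row_mxKr. Qed.

Lemma clst_mk b m c : clst (mk_state b m c) = c.
Proof. by rewrite /clst /mk_state row_mxKr mxE eqxx mulr1n. Qed.

Lemma mk_state_fst b m c : mk_state b m c 0 ifst = b.
Proof. by rewrite /mk_state !row_mxEl mxE eqxx mulr1n. Qed.

Lemma mk_state_mid b m c k : mk_state b m c 0 (imid k) = m 0 k.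
Proof. by rewrite /mk_state row_mxEl row_mxEr. Qed.

Lemma mk_state_lst b m c : mk_state b m c 0 ilst = c.
Proof. by rewrite /mk_state row_mxEr mxE eqxx mulr1n. Qed.

Lemma dot_ge0 m : 0 <= dot m m.
Proof. by apply: sumr_ge0 => i _; rewrite -expr2 sqr_ge0. Qed.

Lemma dotZ b m : dot (b *: m) (b *: m) = b ^+ 2 * dot m m.
Proof. by rewrite /dot mulr_sumr; apply: eq_bigr => i _; rewrite !mxE; ring. Qed.

Lemma dotDr m v w : dot m (v + w) = dot m v + dot m w.
Proof. by rewrite /dot -big_split; apply: eq_bigr => i _; rewrite mxE mulrDr. Qed.

Lemma dot_delta m b i : dot m (b *: delta_mx 0 i) = m 0 i * b.
Proof.
rewrite /dot (bigD1 i)//= big1 ?addr0; first by rewrite !mxE !eqxx mulr1.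
by move=> j ji; rewrite !mxE (negbTE ji) andbF !mulr0.
Qed.

Section Limits.
Context {T : Type} {F : set_system T} {FF : Filter F}.

Lemma cvg_cfst (u : T -> state R d) U : u @ F --> U -> cfst (u t) @[t --> F] --> cfst U.
Proof.
move=> /cvg_mxP uU; rewrite cfstE; under [fun _ => _]eq_fun do rewrite cfstE.
exact: uU.
Qed.

Lemma cvg_cmid (u : T -> state R d) U : u @ F --> U -> cmid (u t) @[t --> F] --> cmid U.
Proof.
move=> /cvg_mxP uU; apply/cvg_mxP => i k; rewrite (ord1 i) cmidE.
by under [fun _ => _]eq_fun do rewrite cmidE; exact: uU.
Qed.

Lemma cvg_clst (u : T -> state R d) U : u @ F --> U -> clst (u t) @[t --> F] --> clst U.
Proof.
move=> /cvg_mxP uU; rewrite clstE; under [fun _ => _]eq_fun do rewrite clstE.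
exact: uU.
Qed.

Lemma cvg_dot (u v : T -> 'rV[R]_d) (m n : 'rV[R]_d) :
  u @ F --> m -> v @ F --> n -> dot (u t) (v t) @[t --> F] --> dot m n.
Proof.
move=> /cvg_mxP um /cvg_mxP vn; apply: cvg_big => [|i _]; [exact: add_continuous|exact: cvgM].
Qed.

Lemma cvg_mk_state (b c : T -> R) (m : T -> 'rV[R]_d) b0 m0 c0 :
  b @ F --> b0 -> m @ F --> m0 -> c @ F --> c0 ->
  (fun t => mk_state (b t) (m t) (c t)) @ F --> mk_state b0 m0 c0.
Proof.
move=> cb /cvg_mxP cm cc; apply/cvg_mxP => i; rewrite (ord1 i) => {i}.
apply: state_index_ind => [|k|].
- by rewrite mk_state_fst; under [fun _ => _]eq_fun do rewrite mk_state_fst.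
- by rewrite mk_state_mid; under [fun _ => _]eq_fun do rewrite mk_state_mid; exact: cm.
- by rewrite mk_state_lst; under [fun _ => _]eq_fun do rewrite mk_state_lst.
Qed.

Lemma cvg_powR (f : T -> R) (c p : R) : 0 < c -> f @ F --> c ->
  f t `^ p @[t --> F] --> c `^ p.
Proof.
move=> c0 fc; apply: (cvg_comp f (@powR R ^~ p) fc).
by have [/derivable1_diffP/differentiable_continuous] := is_derive1_powR p c0.
Qed.

End Limits.

Lemma sqrt_ratio_le1 b c : 0 < c -> (Num.sqrt b / Num.sqrt c <= 1) = (b <= c).
Proof. by move=> c0; rewrite ler_pdivrMr ?sqrtr_gt0// mul1r ler_sqrt// ltW. Qed.

Lemma sqrt_ratio_ge1 b c : 0 <= b -> 0 < c -> (1 <= Num.sqrt b / Num.sqrt c) = (c <= b).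
Proof. by move=> b0 c0; rewrite ler_pdivlMr ?sqrtr_gt0// mul1r ler_sqrt. Qed.

End StateVectors.

Section EquilibriumSystems.
Context {R : realType} {d : nat}.

(* The momenta for which [m^T m / rho + p I] reduces to the scalar
   [dot m m / rho + p]: all of them if [d = 1], only [0] if [d > 1]. *)
Definition isotropic (m : 'rV[R]_d) : Prop :=
  forall i k, m 0 i * m 0 k = dot m m *+ (i == k).

(** All that the scheme uses of the two models. The limits are stated for arbitrary filters so as to
    cover both continuity within a closed cell and one-sided traces. In [consvar_transfer] the state
    [U] sits at the larger potential [b] and is rebuilt from the data of the other side; taking both
    sides equal gives the inversion of the change of variables. *)
Record equilibrium_system (S : system R d) : Prop := EquilibriumSystem {
  cvg_eqvar : forall (T : Type) (F : set_system T), Filter F ->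
    forall (u : T -> state R d) (w : T -> R) U b, adm S U ->
    u @ F --> U -> w @ F --> b ->
    eqvar S (u t) (w t) @[t --> F] --> eqvar S U b;
  cvg_number : forall (T : Type) (F : set_system T), Filter F ->
    forall (u : T -> state R d) U, adm S U -> u @ F --> U ->
    Defs.number S (u t) @[t --> F] --> Defs.number S U;
  cvg_flux : forall (T : Type) (F : set_system T), Filter F ->
    forall (u : T -> state R d) U, adm S U -> u @ F --> U ->
    flux S (u t) @[t --> F] --> flux S U;
  cvg_source : forall (T : Type) (F : set_system T), Filter F ->
    forall (u : T -> state R d) (g : T -> 'rV[R]_d) U b, adm S U ->
    u @ F --> U -> g @ F --> b ->
    source S (u t) (g t) @[t --> F] --> source S U b;
  sourceD : forall U v w, source S U (v + w) = source S U v + source S U w;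
  consvar_transfer : forall U U' b b', adm S U -> adm S U' ->
    eqvar S U b = eqvar S U' b' -> same_regime (Defs.number S U) (Defs.number S U') ->
    b' <= b -> consvar S (Defs.number S U') (eqvar S U' b') b = U;
  flux_balance : forall (u : 'rV[R]_d -> state R d) (w : 'rV[R]_d -> R)
      (x : 'rV[R]_d) i (w' : R) v, isotropic (cmid v) ->
    (\forall y \near x, adm S (u y) /\ eqvar S (u y) (w y) = v) ->
    u @ x --> u x -> is_derive x (delta_mx 0 i) w w' ->
    forall j, is_derive x (delta_mx 0 i) (fun y => flux S (u y) i j)
                (source S (u x) (w' *: delta_mx 0 i) 0 j);
  cmid_eqvar : forall U b, cmid (eqvar S U b) = cmid U;
  eqvar_rest : forall U U' b b', adm S U -> adm S U' -> cmid U = 0 -> cmid U' = 0 ->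
    rest S U b = rest S U' b' -> eqvar S U b = eqvar S U' b';
  number_rest : forall U, cmid U = 0 -> Defs.number S U = 0 }.

Lemma dot00 : dot (0 : 'rV[R]_d) 0 = 0.
Proof. by rewrite /dot big1// => i _; rewrite mxE mul0r. Qed.

Lemma isotropic0 : isotropic 0.
Proof. by move=> i k; rewrite /dot !mxE mul0r big1 ?mul0rn// => l _; rewrite mxE mul0r. Qed.

Lemma same_regime_refl (M : R) : same_regime M M.
Proof. by case: (leP M 1) => [|/ltW]; [left|right]. Qed.

Lemma same_regime_sym (M N : R) : same_regime M N -> same_regime N M.
Proof. by case=> -[]; [left|right]. Qed.

End EquilibriumSystems.

Lemma isotropic1 {R : realType} (m : 'rV[R]_1) : isotropic m.
Proof. by move=> i k; rewrite /dot big_ord1 !ord1. Qed.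

Section EulerEquilibrium.
Context {R : realType} {d : nat}.
Variable gamma : R.
Hypothesis gamma1 : 1 < gamma.
Implicit Types (U V : state R d) (M phi : R).
Notation q U := (dot (cmid U) (cmid U)).

Let gamma0 : 0 < gamma. Proof. exact: lt_trans ltr01 gamma1. Qed.
Let gamma10 : 0 < gamma - 1. Proof. by rewrite subr_gt0. Qed.

Lemma euler_K_gt0 U : euler_adm gamma U -> 0 < euler_K gamma U.
Proof. by move=> [r0 p0]; rewrite divr_gt0// powR_gt0. Qed.

Lemma euler_pressureE U : euler_adm gamma U ->
  euler_pressure gamma U = euler_K gamma U * cfst U `^ gamma.
Proof. by move=> [r0 p0]; rewrite /euler_K divfK// gt_eqF// powR_gt0. Qed.

Lemma euler_pressure_density U : euler_adm gamma U ->
  euler_pressure gamma U / cfst U = euler_K gamma U * cfst U `^ (gamma - 1).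
Proof.
move=> [r0 p0]; rewrite euler_pressureE// -(@mulr_powRB1 _ (cfst U) gamma) ?ltW//.
by rewrite mulrCA mulrAC divff ?mul1r// gt_eqF.
Qed.

Lemma euler_clst U : euler_adm gamma U ->
  clst U = q U / (2 * cfst U) + (gamma - 1)^-1 * euler_K gamma U * cfst U `^ gamma.
Proof.
move=> aU; have [r0 p0] := aU; rewrite -mulrA -euler_pressureE//.
rewrite /euler_pressure dotZ; field.
by rewrite (gt_eqF r0) gt_eqF.
Qed.

Lemma euler_eqvarE U phi : euler_adm gamma U ->
  euler_eqvar gamma U phi =
  mk_state (euler_K gamma U) (cmid U)
    (energy gamma (euler_K gamma U) (q U) (cfst U) + phi).
Proof.
by move=> aU; rewrite /euler_eqvar /energy euler_pressure_density// !mulrA.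
Qed.

Lemma euler_mach_le1 U : euler_adm gamma U ->
  (euler_mach gamma U <= 1) = (sonic gamma (euler_K gamma U) (q U) <= cfst U).
Proof.
move=> aU; have K0 := euler_K_gt0 aU; have [r0 p0] := aU.
rewrite /euler_mach dotZ sqrt_ratio_le1; last first.
  by apply: mulr_gt0; [exact: mulr_gt0|exact: powR_gt0].
by rewrite le_sonic ?dot_ge0// exprVn mulrC.
Qed.

Lemma euler_mach_ge1 U : euler_adm gamma U ->
  (1 <= euler_mach gamma U) = (cfst U <= sonic gamma (euler_K gamma U) (q U)).
Proof.
move=> aU; have K0 := euler_K_gt0 aU; have [r0 p0] := aU.
rewrite /euler_mach sqrt_ratio_ge1 ?dot_ge0//; last first.
  by apply: mulr_gt0; [exact: mulr_gt0|exact: powR_gt0].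
by rewrite dotZ ge_sonic ?dot_ge0// exprVn (mulrC _^-1).
Qed.

(** The density of [U] solves the equation at [phi] and lies on the branch selected by [U'] thanks
    to [on_branch_transfer]; uniqueness on that branch identifies it with the value of [xget]. Zero
    momentum is settled by the explicit formula. *)
Lemma euler_consvar_transfer U U' phi phi' : euler_adm gamma U -> euler_adm gamma U' ->
  euler_eqvar gamma U phi = euler_eqvar gamma U' phi' ->
  same_regime (euler_mach gamma U) (euler_mach gamma U') -> phi' <= phi ->
  euler_consvar gamma (euler_mach gamma U') (euler_eqvar gamma U' phi') phi = U.
Proof.
move=> aU aU' VV' reg phiphi'.
have [r0 p0] := aU; have [r0' p0'] := aU'.
have K0 := euler_K_gt0 aU.
have VE := VV'; rewrite !euler_eqvarE// in VE.
have KK' : euler_K gamma U' = euler_K gamma U by have := congr1 cfst VE; rewrite !cfst_mk.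
have mm' : cmid U' = cmid U by have := congr1 cmid VE; rewrite !cmid_mk.
have := congr1 clst VE; rewrite !clst_mk KK' mm' => EE'.
suff rho : euler_density gamma (euler_mach gamma U') (mk_state (euler_K gamma U) (cmid U)
    (energy gamma (euler_K gamma U) (q U) (cfst U) + phi)) phi = cfst U.
  rewrite -VV' euler_eqvarE// /euler_consvar rho cfst_mk cmid_mk.
  by rewrite -euler_clst// mk_stateK.
rewrite /euler_density.
rewrite cmid_mk. rewrite cfst_mk. rewrite clst_mk.
rewrite [X in _ * X]addrK.
case: eqVneq => [m0|mN0].
  rewrite /energy m0 (_ : dot 0 0 = 0); last first.
    by rewrite /dot big1// => i _; rewrite mxE mul0r.
  rewrite mul0r add0r (_ : _ * _ = cfst U `^ (gamma - 1)).
    by rewrite -powRrM divff ?gt_eqF// powRr1// ltW.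
  by field; rewrite !gt_eqF.
have le1' := euler_mach_le1 aU'; have ge1' := euler_mach_ge1 aU'.
rewrite KK' mm' in le1' ge1'.
have br : on_branch gamma (euler_K gamma U) (q U) (euler_mach gamma U') (cfst U).
  apply: (@on_branch_transfer _ _ _ _ _ _ _ (euler_mach gamma U) _ _ (cfst U')) => //.
  - exact: dot_ge0.
  - exact: euler_mach_le1.
  - exact: euler_mach_ge1.
  - by rewrite -(lerD2r phi) EE' lerD2l.
have rootE rho : euler_root gamma (euler_mach gamma U')
    (mk_state (euler_K gamma U) (cmid U) (energy gamma (euler_K gamma U) (q U) (cfst U) + phi))
    phi rho <-> [/\ 0 < rho,
      energy gamma (euler_K gamma U) (q U) rho = energy gamma (euler_K gamma U) (q U) (cfst U) &
      on_branch gamma (euler_K gamma U) (q U) (euler_mach gamma U') rho].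
  rewrite /euler_root cmid_mk cfst_mk clst_mk -/(energy _ _ _ rho) -/(sonic _ _ _).
  rewrite opprD addrACA subrr addr0; split.
    by move=> [? /eqP E ? ?]; split => //; apply/eqP; rewrite -subr_eq0.
  by move=> [? -> []]; rewrite subrr; split.
apply: xget_unique => [|rho /rootE [rho0 E brho]]; first exact/rootE.
by apply: on_branch_unique brho br _ => //; exact: dot_ge0.
Qed.

Lemma euler_flux_fst U i : euler_flux gamma U i ifst = cmid U 0 i.
Proof. by rewrite /euler_flux !row_mxEl mxE. Qed.

Lemma euler_flux_mid U i k : euler_flux gamma U i (imid k) =
  (cfst U)^-1 * (cmid U 0 i * cmid U 0 k) + euler_pressure gamma U *+ (i == k).
Proof.
rewrite /euler_flux; move: (cmid U) (euler_pressure gamma U) => m p.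
by rewrite row_mxEl row_mxEr !mxE big_ord1 !mxE.
Qed.

Lemma euler_flux_lst U i : euler_flux gamma U i ilst =
  (clst U + euler_pressure gamma U) / cfst U * cmid U 0 i.
Proof. by rewrite /euler_flux row_mxEr !mxE. Qed.

(** The specific total enthalpy is Bernoulli's energy. At constant [V] the energy flux is therefore
    the momentum times a constant minus the potential, which makes its balance immediate. *)
Lemma euler_enthalpy U : euler_adm gamma U ->
  (clst U + euler_pressure gamma U) / cfst U =
  energy gamma (euler_K gamma U) (q U) (cfst U).
Proof.
move=> aU; have [r0 p0] := aU.
rewrite /energy -mulrA -euler_pressure_density//.
rewrite {1}euler_clst// -(mulrA _^-1) -euler_pressureE//; field.
by rewrite (gt_eqF r0) gt_eqF.
Qed.

Section Limits.
Context {T : Type} {F : set_system T} {FF : Filter F}.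
Variables (u : T -> state R d) (U : state R d).
Hypotheses (aU : euler_adm gamma U) (uU : u @ F --> U).

Let r0 : 0 < cfst U. Proof. by have [] := aU. Qed.
Let cr := cvg_cfst uU.
Let cm := cvg_cmid uU.
Let ce := cvg_clst uU.
Let crV : (cfst (u t))^-1 @[t --> F] --> (cfst U)^-1.
Proof. by apply: cvgV => //; rewrite gt_eqF. Qed.

Let crm : (cfst (u t))^-1 *: cmid (u t) @[t --> F] --> (cfst U)^-1 *: cmid U.
Proof. exact: cvgZ. Qed.

Lemma cvg_euler_pressure : euler_pressure gamma (u t) @[t --> F] --> euler_pressure gamma U.
Proof.
apply: cvgMl_tmp; apply: cvgB => //; apply: cvgM; last exact: cvg_dot.
exact: cvgMl_tmp.
Qed.

Lemma cvg_euler_K : euler_K gamma (u t) @[t --> F] --> euler_K gamma U.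
Proof.
apply: cvgM; first exact: cvg_euler_pressure.
by apply: cvgV; [rewrite gt_eqF// powR_gt0|exact: cvg_powR].
Qed.

Lemma cvg_euler_eqvar (w : T -> R) b : w @ F --> b ->
  euler_eqvar gamma (u t) (w t) @[t --> F] --> euler_eqvar gamma U b.
Proof.
move=> wb; apply: cvg_mk_state => //; first exact: cvg_euler_K.
apply: cvgD => //; apply: cvgD.
  apply: cvgM; first exact: cvg_dot.
  apply: cvgV; first by rewrite gt_eqF// mulr_gt0// exprn_gt0.
  apply: cvgMl_tmp; rewrite expr2; under [fun _ => _]eq_fun do rewrite expr2.
  exact: cvgM.
by apply: cvgMl_tmp; apply: cvgM => //; exact: cvg_euler_pressure.
Qed.

Lemma cvg_euler_mach : euler_mach gamma (u t) @[t --> F] --> euler_mach gamma U.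
Proof.
apply: cvgM.
  apply: (cvg_comp _ (@Num.sqrt R) _ (@sqrt_continuous R _)); exact: cvg_dot.
apply: cvgV.
  rewrite sqrtr_eq0 -ltNge; apply: mulr_gt0; last exact: powR_gt0.
  by apply: mulr_gt0 => //; exact: euler_K_gt0.
apply: (cvg_comp _ (@Num.sqrt R) _ (@sqrt_continuous R _)).
apply: cvgM; last exact: cvg_powR.
by apply: cvgMl_tmp; exact: cvg_euler_K.
Qed.

Lemma cvg_euler_flux : euler_flux gamma (u t) @[t --> F] --> euler_flux gamma U.
Proof.
have cp := cvg_euler_pressure; have /cvg_mxP cm' := cm.
apply/cvg_mxP => i; apply: state_index_ind => [|k|].
- by rewrite euler_flux_fst; under [fun _ => _]eq_fun do rewrite euler_flux_fst; exact: cm'.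
- rewrite euler_flux_mid; under [fun _ => _]eq_fun do rewrite euler_flux_mid.
  apply: cvgD; first by apply: cvgM => //; apply: cvgM.
  by case: eqP => _ //; exact: cvg_cst.
- rewrite euler_flux_lst; under [fun _ => _]eq_fun do rewrite euler_flux_lst.
  by apply: cvgM => //; apply: cvgM => //; exact: cvgD.
Qed.

Lemma cvg_euler_source (w : T -> 'rV[R]_d) (b : 'rV[R]_d) : w @ F --> b ->
  euler_source (u t) (w t) @[t --> F] --> euler_source U b.
Proof.
move=> wb; apply: cvg_mk_state; first exact: cvg_cst.
  by apply: cvgZ => //; exact: cvgN.
by apply: cvgN; exact: cvg_dot.
Qed.

End Limits.

Lemma euler_sourceD U v w : euler_source U (v + w) = euler_source U v + euler_source U w.
Proof.
apply/rowP; apply: state_index_ind => [|k|]; rewrite [RHS]mxE.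
- by rewrite !mk_state_fst addr0.
- by rewrite !mk_state_mid scalerDr mxE.
- by rewrite !mk_state_lst dotDr opprD.
Qed.

(** At constant [V] the mass flux is constant, the energy flux is affine in the potential, and
    isotropy reduces the momentum flux to the thrust on the diagonal and 0 off it. Only the thrust
    requires [bernoulli]. *)
Lemma euler_flux_balance (u : 'rV[R]_d -> state R d) (w : 'rV[R]_d -> R) x i (w' : R) v :
  isotropic (cmid v) ->
  (\forall y \near x, euler_adm gamma (u y) /\ euler_eqvar gamma (u y) (w y) = v) ->
  u @ x --> u x -> is_derive x (delta_mx 0 i) w w' ->
  forall j, is_derive x (delta_mx 0 i) (fun y => euler_flux gamma (u y) i j)
    (euler_source (u x) (w' *: delta_mx 0 i) 0 j).
Proof.
move=> iso uv cu dw.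
have uvE : \forall y \near x, [/\ euler_adm gamma (u y), euler_K gamma (u y) = cfst v,
    cmid (u y) = cmid v &
    energy gamma (cfst v) (dot (cmid v) (cmid v)) (cfst (u y)) + w y = clst v].
  apply: filterS uv => y [ay <-]; rewrite euler_eqvarE//.
  by rewrite cfst_mk cmid_mk clst_mk.
have [ax Kx mx Ex] := nbhs_singleton uvE.
have K0 : 0 < cfst v by rewrite -Kx euler_K_gt0.
have dT : is_derive x (delta_mx 0 i)
    (fun y => thrust gamma (cfst v) (dot (cmid v) (cmid v)) (cfst (u y))) (- cfst (u x) * w').
  apply: (@bernoulli _ _ _ _ _ _ _ _ (fun y => cfst (u y)) w _ _ _ (clst v)) => //.
  - exact: dot_ge0.
  - exact: (cvg_cfst cu).
  - by apply: filterS uvE => y [[]].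
  - by apply: filterS uvE => y [].
apply: state_index_ind => [|k|].
- rewrite mk_state_fst; apply: (@near_eq_is_derive _ _ _ (cst (cmid v 0 i))).
    by apply: filterS uvE => y [_ _ my _]; rewrite euler_flux_fst my.
- rewrite mk_state_mid.
  apply: (@near_eq_is_derive _ _ _ (cst ((i == k)%:R) *
     (fun y => thrust gamma (cfst v) (dot (cmid v) (cmid v)) (cfst (u y))))).
    apply: filterS uvE => y [ay Ky my _]; rewrite euler_flux_mid my iso euler_pressureE// Ky.
    rewrite !fctE /= /thrust mulrnAr -mulrnDl mulrC.
    by rewrite -[RHS]mulr_natr (mulrC (cfst (u y))^-1).
  apply: is_derive_eq; rewrite !mxE eqxx /GRing.scale/= mulr0 addr0.
  by rewrite (eq_sym k); ring.
- rewrite mk_state_lst dot_delta mx.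
  apply: (@near_eq_is_derive _ _ _ (cst (cmid v 0 i) * (cst (clst v) - w))).
    apply: filterS uvE => y [ay Ky my Ey]; rewrite euler_flux_lst euler_enthalpy//.
    by rewrite my Ky !fctE /= -Ey addrK mulrC.
  by apply: is_derive_eq; rewrite /GRing.scale/=; ring.
Qed.

Lemma euler_equilibrium_system : equilibrium_system (euler gamma d).
Proof.
split => /=.
- by move=> *; exact: cvg_euler_eqvar.
- by move=> *; exact: cvg_euler_mach.
- by move=> *; exact: cvg_euler_flux.
- by move=> *; exact: cvg_euler_source.
- exact: euler_sourceD.
- exact: euler_consvar_transfer.
- exact: euler_flux_balance.
- by move=> U b; rewrite cmid_mk.
- move=> U U' b b' aU aU' m0 m0' [K E].
  by rewrite /euler_eqvar m0 m0' K dot00 !mul0r !add0r E.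
- by move=> U m0; rewrite /euler_mach m0 scaler0 dot00 sqrtr0 mul0r.
Qed.

End EulerEquilibrium.

Section RipaEquilibrium.
Context {R : realType} {d : nat}.
Variable g : R.
Hypothesis g0 : 0 < g.
Implicit Types (U V : state R d) (M b : R).
Notation q U := (dot (cmid U) (cmid U)).

Let two1 : (1 : R) < 2. Proof. by rewrite ltr1n. Qed.

(* The Ripa model is an isentropic gas with ratio of specific heats 2 and
   pressure [K h^2], where [K = g theta / 2], in the potential
   [g theta b]. *)
Lemma ripa_energyE (th p h : R) : 0 < h ->
  energy 2 (2^-1 * (g * th)) p h = p / (2 * h ^+ 2) + g * th * h.
Proof.
move=> h0; rewrite /energy (_ : 2 - 1 = 1 :> R); last by lra.
by rewrite powRr1 ?ltW//; field; exact: lt0r_neq0.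
Qed.

Lemma ripa_thrustE (th p h : R) : 0 < h ->
  thrust 2 (2^-1 * (g * th)) p h = p / h + 2^-1 * g * h ^+ 2 * th.
Proof. by move=> h0; rewrite /thrust (powR_mulrn 2) ?ltW//; ring. Qed.

Lemma ripa_clst U : ripa_adm U -> clst U = cfst U * ripa_theta U.
Proof. by move=> [h0 _]; rewrite /ripa_theta mulrC divfK// gt_eqF. Qed.

Lemma ripa_eqvarE U b : ripa_adm U ->
  ripa_eqvar g U b =
  mk_state (energy 2 (2^-1 * (g * ripa_theta U)) (q U) (cfst U) + g * ripa_theta U * b)
    (cmid U) (ripa_theta U).
Proof. by move=> [h0 _]; rewrite ripa_energyE// /ripa_eqvar mulrDr addrA. Qed.

Let K_gt0 U : ripa_adm U -> 0 < 2^-1 * (g * ripa_theta U).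
Proof. by move=> [_ t0]; apply: mulr_gt0; [rewrite invr_gt0|exact: mulr_gt0]. Qed.

Lemma ripa_froude_le1 U : ripa_adm U ->
  (ripa_froude g U <= 1) = (sonic 2 (2^-1 * (g * ripa_theta U)) (q U) <= cfst U).
Proof.
move=> aU; have [h0 t0] := aU.
rewrite /ripa_froude dotZ sqrt_ratio_le1; last first.
  by apply: mulr_gt0 => //; exact: mulr_gt0.
rewrite le_sonic ?dot_ge0 ?K_gt0// (_ : 2 - 1 = 1 :> R); last by lra.
rewrite (powRr1 (ltW h0)) exprVn (mulrC _^-1) (mulrA 2) divff ?mul1r//.
by rewrite (mulrAC g).
Qed.

Lemma ripa_froude_ge1 U : ripa_adm U ->
  (1 <= ripa_froude g U) = (cfst U <= sonic 2 (2^-1 * (g * ripa_theta U)) (q U)).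
Proof.
move=> aU; have [h0 t0] := aU.
rewrite /ripa_froude sqrt_ratio_ge1 ?dot_ge0//; last first.
  by apply: mulr_gt0 => //; exact: mulr_gt0.
rewrite dotZ ge_sonic ?dot_ge0 ?K_gt0// (_ : 2 - 1 = 1 :> R); last by lra.
rewrite (powRr1 (ltW h0)) exprVn (mulrC _^-1) (mulrA 2) divff ?mul1r//.
by rewrite (mulrAC g).
Qed.

(** The positive roots of the cubic are exactly the heights with the energy of [U], so the branch
    selected by the Froude number is an extremal root: the largest when subsonic in the gas analogy,
    the smallest when supersonic. *)
Lemma ripa_consvar_transfer U U' b b' : ripa_adm U -> ripa_adm U' ->
  ripa_eqvar g U b = ripa_eqvar g U' b' ->
  same_regime (ripa_froude g U) (ripa_froude g U') -> b' <= b ->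
  ripa_consvar g (ripa_froude g U') (ripa_eqvar g U' b') b = U.
Proof.
move=> aU aU' VV' reg bb'.
have [h0 t0] := aU; have [h0' t0'] := aU'.
have K0 := K_gt0 aU.
have VE := VV'; rewrite !ripa_eqvarE// in VE.
have tt' : ripa_theta U' = ripa_theta U by have := congr1 clst VE; rewrite !clst_mk.
have mm' : cmid U' = cmid U by have := congr1 cmid VE; rewrite !cmid_mk.
have := congr1 cfst VE; rewrite !cfst_mk tt' mm' => EE'.
pose th := ripa_theta U; pose E := energy 2 (2^-1 * (g * th)) (q U).
suff height : ripa_height g (ripa_froude g U')
    (mk_state (E (cfst U) + g * th * b) (cmid U) th) b = cfst U.
  rewrite -VV' ripa_eqvarE// /ripa_consvar height clst_mk cmid_mk.
  by rewrite -ripa_clst// mk_stateK.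
rewrite /ripa_height cmid_mk cfst_mk clst_mk.
case: eqVneq => [m0|mN0].
  rewrite /E ripa_energyE// m0 (_ : dot 0 0 = 0); last first.
    by rewrite /dot big1// => i _; rewrite mxE mul0r.
  by field; rewrite !gt_eqF.
have le1' := ripa_froude_le1 aU'; have ge1' := ripa_froude_ge1 aU'.
rewrite tt' mm' in le1' ge1'.
have br : on_branch 2 (2^-1 * (g * th)) (q U) (ripa_froude g U') (cfst U).
  apply: (@on_branch_transfer _ _ _ _ _ _ _ (ripa_froude g U) _ _ (cfst U')) => //.
  - exact: dot_ge0.
  - exact: ripa_froude_le1.
  - exact: ripa_froude_ge1.
  - by rewrite -(lerD2r (g * th * b)) EE' lerD2l ler_pM2l// mulr_gt0.
have cubicE h : 0 < h -> ripa_cubic g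
    (mk_state (E (cfst U) + g * th * b) (cmid U) th) b h <-> E h = E (cfst U).
  move=> hp; rewrite /ripa_cubic cmid_mk cfst_mk clst_mk.
  (* The cubic is Bernoulli's equation multiplied by [h^2]. *)
  have -> : g * th * h ^+ 3 - (E (cfst U) + g * th * b - g * b * th) * h ^+ 2 + 2^-1 * q U
      = h ^+ 2 * (E h - E (cfst U)).
    rewrite {2}/E ripa_energyE//; field; exact: lt0r_neq0.
  split=> [/eqP|->]; last by rewrite subrr mulr0.
  by rewrite mulf_eq0 expf_eq0/= gt_eqF//= subr_eq0 => /eqP.
have root : ripa_root g (ripa_froude g U')
    (mk_state (E (cfst U) + g * th * b) (cmid U) th) b (cfst U).
  split => //; first exact/cubicE.
    by move=> M1 h hp /(cubicE _ hp) Eh; apply: on_branch_max br M1 hp Eh => //; exact: dot_ge0.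
  by move=> M1 h hp /(cubicE _ hp) Eh; apply: on_branch_min br M1 hp Eh => //; exact: dot_ge0.
apply: xget_unique => // h [hp ch lh gh]; case: root => _ cU lU gU.
(* Two largest roots coincide, and so do two smallest ones. *)
apply/le_anti; have [M1|/ltW M1] := leP (ripa_froude g U') 1.
  by rewrite lU// lh.
by rewrite gh// gU.
Qed.

Lemma ripa_flux_fst U i : ripa_flux g U i ifst = cmid U 0 i.
Proof. by rewrite /ripa_flux !row_mxEl mxE. Qed.

Lemma ripa_flux_mid U i k : ripa_flux g U i (imid k) =
  (cfst U)^-1 * (cmid U 0 i * cmid U 0 k) + ripa_pressure g U *+ (i == k).
Proof.
rewrite /ripa_flux; move: (cmid U) (ripa_pressure g U) => m p.
by rewrite row_mxEl row_mxEr !mxE big_ord1 !mxE.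
Qed.

Lemma ripa_flux_lst U i : ripa_flux g U i ilst = ripa_theta U * cmid U 0 i.
Proof. by rewrite /ripa_flux row_mxEr !mxE. Qed.

Section Limits.
Context {T : Type} {F : set_system T} {FF : Filter F}.
Variables (u : T -> state R d) (U : state R d).
Hypotheses (aU : ripa_adm U) (uU : u @ F --> U).

Let h0 : 0 < cfst U. Proof. by have [] := aU. Qed.
Let ch := cvg_cfst uU.
Let cm := cvg_cmid uU.
Let chV : (cfst (u t))^-1 @[t --> F] --> (cfst U)^-1.
Proof. by apply: cvgV => //; rewrite gt_eqF. Qed.
Let ct : ripa_theta (u t) @[t --> F] --> ripa_theta U.
Proof. by apply: cvgM => //; exact: cvg_clst. Qed.

Let ch2 : cfst (u t) ^+ 2 @[t --> F] --> cfst U ^+ 2.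
Proof. by rewrite expr2; under [fun _ => _]eq_fun do rewrite expr2; exact: cvgM. Qed.

Lemma cvg_ripa_pressure : ripa_pressure g (u t) @[t --> F] --> ripa_pressure g U.
Proof. by apply: cvgM => //; exact: cvgMl_tmp. Qed.

Lemma cvg_ripa_eqvar (w : T -> R) b : w @ F --> b ->
  ripa_eqvar g (u t) (w t) @[t --> F] --> ripa_eqvar g U b.
Proof.
move=> wb; apply: cvg_mk_state => //; apply: cvgD.
  apply: cvgM; first exact: cvg_dot.
  apply: cvgV; first by rewrite gt_eqF// mulr_gt0// exprn_gt0.
  exact: cvgMl_tmp.
by apply: cvgM; [exact: cvgMl_tmp|exact: cvgD].
Qed.

Lemma cvg_ripa_froude : ripa_froude g (u t) @[t --> F] --> ripa_froude g U.
Proof.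
have [_ t0] := aU; apply: cvgM.
  apply: (cvg_comp _ (@Num.sqrt R) _ (@sqrt_continuous R _)).
  by apply: cvg_dot; exact: cvgZ.
apply: cvgV.
  by rewrite sqrtr_eq0 -ltNge; apply: mulr_gt0 => //; exact: mulr_gt0.
apply: (cvg_comp _ (@Num.sqrt R) _ (@sqrt_continuous R _)).
by apply: cvgM => //; exact: cvgMl_tmp.
Qed.

Lemma cvg_ripa_flux : ripa_flux g (u t) @[t --> F] --> ripa_flux g U.
Proof.
have cp := cvg_ripa_pressure; have /cvg_mxP cm' := cm.
apply/cvg_mxP => i; apply: state_index_ind => [|k|].
- by rewrite ripa_flux_fst; under [fun _ => _]eq_fun do rewrite ripa_flux_fst; exact: cm'.
- rewrite ripa_flux_mid; under [fun _ => _]eq_fun do rewrite ripa_flux_mid.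
  apply: cvgD; first by apply: cvgM => //; apply: cvgM.
  by case: eqP => _ //; exact: cvg_cst.
- rewrite ripa_flux_lst; under [fun _ => _]eq_fun do rewrite ripa_flux_lst.
  by apply: cvgM => //.
Qed.

Lemma cvg_ripa_source (w : T -> 'rV[R]_d) (b : 'rV[R]_d) : w @ F --> b ->
  ripa_source g (u t) (w t) @[t --> F] --> ripa_source g U b.
Proof.
move=> wb; apply: cvg_mk_state; [exact: cvg_cst| |exact: cvg_cst].
by apply: cvgZ => //; apply: cvgN; apply: cvgM => //; exact: cvgMl_tmp.
Qed.

End Limits.

Lemma ripa_sourceD U v w : ripa_source g U (v + w) = ripa_source g U v + ripa_source g U w.
Proof.
apply/rowP; apply: state_index_ind => [|k|]; rewrite [RHS]mxE.
- by rewrite !mk_state_fst addr0.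
- by rewrite !mk_state_mid scalerDr mxE.
- by rewrite !mk_state_lst addr0.
Qed.

(** With [theta] constant, [bernoulli] applies to the potential [g theta b]; the flux of [h theta]
    is constant, matching its zero source. *)
Lemma ripa_flux_balance (u : 'rV[R]_d -> state R d) (w : 'rV[R]_d -> R) x i (w' : R) v :
  isotropic (cmid v) ->
  (\forall y \near x, ripa_adm (u y) /\ ripa_eqvar g (u y) (w y) = v) ->
  u @ x --> u x -> is_derive x (delta_mx 0 i) w w' ->
  forall j, is_derive x (delta_mx 0 i) (fun y => ripa_flux g (u y) i j)
    (ripa_source g (u x) (w' *: delta_mx 0 i) 0 j).
Proof.
move=> iso uv cu dw; pose K := 2^-1 * (g * clst v).
have uvE : \forall y \near x, [/\ ripa_adm (u y), ripa_theta (u y) = clst v,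
    cmid (u y) = cmid v &
    energy 2 K (dot (cmid v) (cmid v)) (cfst (u y)) + g * clst v * w y = cfst v].
  apply: filterS uv => y [ay vE]; rewrite /K -vE ripa_eqvarE//.
  by rewrite cfst_mk cmid_mk clst_mk.
have [ax tx mx Ex] := nbhs_singleton uvE.
have K0 : 0 < K by rewrite /K -tx; exact: K_gt0.
have dT : is_derive x (delta_mx 0 i)
    (fun y => thrust 2 K (dot (cmid v) (cmid v)) (cfst (u y)))
    (- cfst (u x) * (g * clst v * w')).
  apply: (@bernoulli _ _ _ _ _ _ _ _ (fun y => cfst (u y))
    (fun y => g * clst v * w y) _ _ _ (cfst v)) => //.
  - exact: dot_ge0.
  - exact: (cvg_cfst cu).
  - by apply: filterS uvE => y [[]].
  - by apply: filterS uvE => y [].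
apply: state_index_ind => [|k|].
- rewrite mk_state_fst; apply: (@near_eq_is_derive _ _ _ (cst (cmid v 0 i))).
    by apply: filterS uvE => y [_ _ my _]; rewrite ripa_flux_fst my.
- rewrite mk_state_mid.
  apply: (@near_eq_is_derive _ _ _ (cst ((i == k)%:R) *
     (fun y => thrust 2 K (dot (cmid v) (cmid v)) (cfst (u y))))).
    apply: filterS uvE => y [[hy ty] ty' my _]; rewrite ripa_flux_mid my iso.
    rewrite !fctE /= ripa_thrustE// /ripa_pressure ty' mulrnAr -mulrnDl mulrC.
    by rewrite -[RHS]mulr_natr (mulrC (cfst (u y))^-1).
  apply: is_derive_eq; rewrite tx !mxE eqxx /GRing.scale/= mulr0 addr0.
  by rewrite (eq_sym k); ring.
- rewrite mk_state_lst.
  apply: (@near_eq_is_derive _ _ _ (cst (clst v * cmid v 0 i))).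
    by apply: filterS uvE => y [_ ty my _]; rewrite ripa_flux_lst my ty.
Qed.

Lemma ripa_equilibrium_system : equilibrium_system (ripa g d).
Proof.
split => /=.
- by move=> *; exact: cvg_ripa_eqvar.
- by move=> *; exact: cvg_ripa_froude.
- by move=> *; exact: cvg_ripa_flux.
- by move=> *; exact: cvg_ripa_source.
- exact: ripa_sourceD.
- exact: ripa_consvar_transfer.
- exact: ripa_flux_balance.
- by move=> U b; rewrite cmid_mk.
- move=> U U' b b' aU aU' m0 m0' [K E].
  by rewrite /ripa_eqvar m0 m0' K dot00 !mul0r !add0r E.
- by move=> U m0; rewrite /ripa_froude m0 scaler0 dot00 sqrtr0 mul0r.
Qed.

End RipaEquilibrium.

(** * Exactness of the scheme *)

Section ContinuouslyDifferentiable.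
Context {R : realType} {d : nat}.
Implicit Types f g : 'rV[R]_d -> R.

Lemma C1_is_derive f : continuous f ->
  (forall i, exists2 f' : 'rV[R]_d -> R, continuous f' &
     forall x, is_derive x (delta_mx 0 i) f (f' x)) -> C1 f.
Proof.
move=> cf df; split=> // [i x|i]; first by have [f' _ /(_ x) []] := df i.
have [f' cf' f'E] := df i; suff -> : (fun x => 'D_(delta_mx 0 i) f x) = f' by [].
by apply/funext => x; have [] := f'E x.
Qed.

Lemma is_derive_C1 f i x : C1 f -> is_derive x (delta_mx 0 i) f ('D_(delta_mx 0 i) f x).
Proof. by move=> [_ df _]; exact: derivableP. Qed.

Lemma C1_cst (c : R) : C1 (cst c : 'rV[R]_d -> R).
Proof.
apply: C1_is_derive => [|i]; first exact: cst_continuous.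
by exists (cst 0) => [|x]; [exact: cst_continuous|exact: is_derive_cst].
Qed.

Lemma C1D f g : C1 f -> C1 g -> C1 (fun x => f x + g x).
Proof.
move=> cf cg; have [cf0 _ cf1] := cf; have [cg0 _ cg1] := cg.
apply: C1_is_derive => [x|i]; first exact: (cvgD (cf0 x) (cg0 x)).
exists (fun x => 'D_(delta_mx 0 i) f x + 'D_(delta_mx 0 i) g x) => x.
  exact: (cvgD (cf1 i x) (cg1 i x)).
by apply: is_deriveD; exact: is_derive_C1.
Qed.

Lemma C1M f g : C1 f -> C1 g -> C1 (fun x => f x * g x).
Proof.
move=> cf cg; have [cf0 _ cf1] := cf; have [cg0 _ cg1] := cg.
apply: C1_is_derive => [x|i]; first exact: (cvgM (cf0 x) (cg0 x)).
exists (fun x => f x * 'D_(delta_mx 0 i) g x + g x * 'D_(delta_mx 0 i) f x) => x.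
  exact: (cvgD (cvgM (cf0 x) (cg1 i x)) (cvgM (cg0 x) (cf1 i x))).
by apply: is_deriveM; exact: is_derive_C1.
Qed.

Lemma C1_coord l : C1 (fun x : 'rV[R]_d => x 0 l).
Proof.
apply: C1_is_derive => [|i]; first exact: coord_continuous.
exists (cst ((delta_mx 0 i : 'rV[R]_d) 0 l)) => [|x]; first exact: cst_continuous.
have E : \forall h \near (0 : R)^',
    (cst ((delta_mx 0 i : 'rV[R]_d) 0 l)) h =
    h^-1 *: ((h *: (delta_mx 0 i : 'rV[R]_d) + x) 0 l - x 0 l).
  near=> h; have h0 : h != 0 by near: h; exact: nbhs_dnbhs_neq.
  by rewrite !mxE addrK /GRing.scale/= mulrA mulVf ?mul1r.
have C : (h^-1 *: ((h *: (delta_mx 0 i : 'rV[R]_d) + x) 0 l - x 0 l)) @[h --> (0:R)^'] -->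
    (delta_mx 0 i : 'rV[R]_d) 0 l.
  by apply: cvg_trans (near_eq_cvg E) _; exact: cvg_cst.
by apply: DeriveDef; [exact: cvgP C|exact: cvg_lim C].
Unshelve. all: by end_near. Qed.

(** The operation is left abstract to serve both the sums and the products in a polynomial. *)
Lemma C1_big (op : R -> R -> R) (x0 : R) I (r : seq I) (P : pred I) (F : I -> 'rV[R]_d -> R) :
  (forall f g, C1 f -> C1 g -> C1 (fun x => op (f x) (g x))) ->
  (forall i, C1 (F i)) -> C1 (fun x => \big[op/x0]_(i <- r | P i) F i x).
Proof.
move=> Cop CF; elim: r => [|i r IH].
  by under [fun x => _]eq_fun do rewrite big_nil; exact: C1_cst.
under [fun x => _]eq_fun do rewrite big_cons.
by case: (P i) => //; apply: Cop.
Qed.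

Lemma C1X f n : C1 f -> C1 (fun x => f x ^+ n).
Proof.
move=> cf; elim: n => [|n IH]; first exact: C1_cst.
by under [fun x => _]eq_fun do rewrite exprS; exact: C1M.
Qed.

Lemma polynomial_C1 k f : polynomial_upto k f -> C1 f.
Proof.
move=> [c cE]; rewrite (funext cE).
apply: C1_big => [|a]; first exact: C1D.
apply: C1M; first exact: C1_cst.
by apply: C1_big => [|i]; [exact: C1M|exact/C1X/C1_coord].
Qed.

(** Places the cellwise constant [V] in the discrete space for every degree, 0 included; only the
    coefficient of the zero multi-index is kept. *)
Lemma polynomial_cst k (c : R) : polynomial_upto k (fun _ : 'rV[R]_d => c).
Proof.
pose a0 : {ffun 'I_d -> 'I_k.+1} := [ffun=> ord0].
exists (fun a => if a == a0 then c else 0) => x.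
rewrite (bigD1 a0)/=; last by rewrite big1// => i _; rewrite ffunE.
rewrite eqxx big1 => [|i _]; last by rewrite ffunE expr0.
by rewrite mulr1 big1 ?addr0// => a /andP[_ /negbTE ->]; rewrite mul0r.
Qed.

End ContinuouslyDifferentiable.

(** * Numerical fluxes at smooth interfaces and stationary shocks *)

Section InterfaceFlux.
Context {R : realType} {d : nat}.
Variables (S : system R d) (Fhat : state R d -> state R d -> 'rV[R]_d -> state R d).
Implicit Types (U : state R d) (n : 'rV[R]_d).

(** Equal normal fluxes put the jump [UR - UL] in the left kernel of the Roe matrix. In an
    eigenbasis each coordinate of the jump or its eigenvalue is 0, so the jump is also killed by the
    absolute value of the matrix and the dissipation disappears. *)
Lemma roe_stationary n UL UR : adm S UL -> adm S UR -> dot n n = 1 ->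
  n *m flux S UL = n *m flux S UR -> roe_flux S Fhat -> Fhat UL UR n = n *m flux S UL.
Proof.
move=> aL aR nn FE [A [absA roe]].
have [[P [l [Pu AE absE]]] AF _ ->] := roe _ _ _ aL aR nn.
have D0 : (UR - UL) *m invmx P *m diag_mx l = 0.
  have := AF; rewrite AE FE subrr -!mulmxA => /(congr1 (mulmx^~ (invmx P))).
  by rewrite mul0mx !mulmxA mulmxK// => ->.
have absD0 : (UR - UL) *m invmx P *m diag_mx (map_mx Num.norm l) = 0.
  apply/rowP => j; have := congr1 (fun B : 'rV_(1 + d + 1) => B 0 j) D0.
  rewrite !mul_mx_diag !mxE => /eqP; rewrite mulf_eq0 => /orP[/eqP ->|/eqP ->].
    by rewrite mul0r.
  by rewrite normr0 mulr0.
rewrite absE !mulmxA absD0 mul0mx subr0 FE scalerDr -scalerDl.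
by rewrite -div1r -splitr scale1r.
Qed.

(** For a left shock [aL = 0] selects the left flux outright. For a right shock [aL < aM < aR = 0]
    selects the third case, whose correction carries the factor [aR], and the right flux equals the
    left one. *)
Lemma hllc_stationary n UL UR : adm S UL -> adm S UR -> dot n n = 1 ->
  stationary_shock S n UL UR -> hllc_flux S Fhat -> Fhat UL UR n = n *m flux S UL.
Proof.
move=> aL aR nn sh [sL [sM [sR hllc]]].
have [/andP[LM MR] _ L0 R0 ->] := hllc _ _ _ aL aR nn.
case: sh => sh; first by rewrite L0// lexx.
have FE : n *m flux S UL = n *m flux S UR by case: sh.
rewrite R0// in MR *.
rewrite (lt_geF MR) (lt_geF (lt_trans LM MR)) lexx scale0r addr0.
by rewrite FE.
Qed.

Hypotheses (HS : equilibrium_system S) (cFhat : consistent_flux S Fhat).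

Lemma consvarK U b : adm S U -> consvar S (Defs.number S U) (eqvar S U b) b = U.
Proof. by move=> aU; apply: consvar_transfer => //; exact: same_regime_refl. Qed.

(** The right-hand side is the flux of the reconstructed interior state, exactly the term that the
    hydrostatic correction subtracts. At a smooth interface both reconstructions yield the state
    with the larger potential; at a shock the potentials agree and reconstruction changes
    nothing. *)
Lemma hr_flux_stationary n UI UE wI wE : adm S UI -> adm S UE -> dot n n = 1 ->
  (eqvar S UI wI = eqvar S UE wE /\ same_regime (Defs.number S UI) (Defs.number S UE)) \/
  (wI = wE /\ Fhat UI UE n = n *m flux S UI) ->
  Fhat (consvar S (Defs.number S UI) (eqvar S UI wI) (Num.max wI wE))
       (consvar S (Defs.number S UE) (eqvar S UE wE) (Num.max wI wE)) n =
  n *m flux S (consvar S (Defs.number S UI) (eqvar S UI wI) (Num.max wI wE)).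
Proof.
move=> aI aE nn [[VV reg]|[<- FF]]; last by rewrite maxxx !consvarK.
have [le|/ltW le] := leP wE wI.
  rewrite consvarK//.
  by rewrite (consvar_transfer HS aI aE VV reg le); exact: cFhat.
rewrite consvarK//.
rewrite (consvar_transfer HS aE aI (esym VV) (same_regime_sym reg) le).
exact: cFhat.
Qed.

End InterfaceFlux.

(** * Balance of flux and source in one cell *)

Section CellBalance.
Context {R : realType} {d : nat}.
Variables (S : system R d) (Fhat : state R d -> state R d -> 'rV[R]_d -> state R d).
Hypothesis HS : equilibrium_system S.
Implicit Types (T : box R d) (w f : 'rV[R]_d -> R) (Uini Ub : 'rV[R]_d -> state R d)
  (x n : 'rV[R]_d).

Lemma near_interior T x (P : 'rV[R]_d -> Prop) : interior_box T x ->
  (forall y, interior_box T y -> P y) -> \forall y \near x, P y.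
Proof.
move=> Tx TP; apply: (@filterS _ _ _ (interior_box T)) => //.
by apply: open_nbhs_nbhs; split; [exact: interior_box_open|].
Qed.

Lemma cvg_interior (X : topologicalType) T x (h : 'rV[R]_d -> X) : interior_box T x ->
  {within closed_box T, continuous h} -> h @ x --> h x.
Proof.
move=> Tx /subspace_continuousP/(_ _ (interior_boxW Tx)) hx.
move: hx; rewrite within_interior//.
by apply: near_interior Tx _ => y /interior_boxW.
Qed.

(** Additivity splits the source into one contribution per direction, the form in which
    [flux_balance] supplies it. *)
Lemma source_sum U (G : 'rV[R]_d) :
  source S U G = \sum_i source S U (G 0 i *: delta_mx 0 i).
Proof.
have s0 : source S U 0 = 0.
  by have /eqP := sourceD HS U 0 0; rewrite addr0 -subr_eq0 opprD addNKr oppr_eq0 => /eqP.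
rewrite -(big_morph (source S U) (sourceD HS U) s0); congr (source S U _).
exact: row_sum_delta.
Qed.

Section OneCell.
Variables (T : box R d) (w f : 'rV[R]_d -> R) (Uini Ub : 'rV[R]_d -> state R d).
Variables (v : state R d) (phi : 'rV[R]_d -> state R d)
  (p : 'I_(1 + d + 1) -> 'rV[R]_d -> R).
Hypotheses (T0 : proper_box T) (f1 : C1 f) (wf : {in interior_box T, w =1 f}).
Hypotheses (UiniUb : {in interior_box T, Uini =1 Ub})
  (cUb : {within closed_box T, continuous Ub})
  (aUb : forall x, closed_box T x -> adm S (Ub x)).
Hypotheses (Vv : forall x, interior_box T x -> eqvar S (Uini x) (w x) = v)
  (iso : isotropic (cmid v)).
Hypotheses (p1 : forall j, C1 (p j))
  (phip : forall j, {in interior_box T, (fun x => phi x 0 j) =1 p j}).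

(** The integrands with the data replaced by their continuous extensions: [Phi i] is the tested flux
    in direction [i], and its derivative in that direction is [A i] (derivative on the test
    function) plus [B i] (source). *)
Let Phi i x := \sum_j flux S (Ub x) i j * p j x.
Let A i x := \sum_j flux S (Ub x) i j * 'D_(delta_mx 0 i) (p j) x.
Let B i x := \sum_j source S (Ub x) ('D_(delta_mx 0 i) f x *: delta_mx 0 i) 0 j * p j x.

Let within_sum (F G : 'I_(1 + d + 1) -> 'rV[R]_d -> R) :
  (forall x j, closed_box T x ->
    F j y @[y --> within (closed_box T) (nbhs x)] --> F j x) ->
  (forall j, continuous (G j)) ->
  {within closed_box T, continuous (fun x => \sum_j F j x * G j x)}.
Proof.
move=> cF cG; apply/subspace_continuousP => x Tx.
apply: cvg_big => [|j _]; first exact: add_continuous.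
have cGj : G j y @[y --> within (closed_box T) (nbhs x)] --> G j x.
  by apply: cvg_within_filter; exact: cG.
exact: cvgM (cF _ j Tx) cGj.
Qed.

Let cvg_Ub x : closed_box T x -> Ub @ within (closed_box T) (nbhs x) --> Ub x.
Proof. by move=> Tx; have /subspace_continuousP/(_ _ Tx) := cUb. Qed.

Let cvg_fluxb i x j : closed_box T x ->
  flux S (Ub y) i j @[y --> within (closed_box T) (nbhs x)] --> flux S (Ub x) i j.
Proof.
move=> Tx.
have /cvg_mxP := cvg_flux HS (within_filter (closed_box T) (nbhs_filter x))
  (aUb Tx) (cvg_Ub Tx).
exact.
Qed.

Let cvg_sourceb i x j : closed_box T x ->
  source S (Ub y) ('D_(delta_mx 0 i) f y *: delta_mx 0 i) 0 j
    @[y --> within (closed_box T) (nbhs x)]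
  --> source S (Ub x) ('D_(delta_mx 0 i) f x *: delta_mx 0 i) 0 j.
Proof.
move=> Tx.
have cg : ('D_(delta_mx 0 i) f y *: delta_mx 0 i : 'rV[R]_d)
    @[y --> within (closed_box T) (nbhs x)] --> 'D_(delta_mx 0 i) f x *: delta_mx 0 i.
  by apply: cvgZr_tmp; apply: cvg_within_filter; case: f1 => _ _ /(_ i x).
have /cvg_mxP := cvg_source HS (within_filter (closed_box T) (nbhs_filter x))
  (aUb Tx) (cvg_Ub Tx) cg.
exact.
Qed.

Let cPhi i : {within closed_box T, continuous (Phi i)}.
Proof. by apply: within_sum => [x j|j]; [exact: cvg_fluxb|case: (p1 j)]. Qed.

Let cA i : {within closed_box T, continuous (A i)}.
Proof. by apply: within_sum => [x j|j]; [exact: cvg_fluxb|case: (p1 j)]. Qed.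

Let cB i : {within closed_box T, continuous (B i)}.
Proof. by apply: within_sum => [x j|j]; [exact: cvg_sourceb|case: (p1 j)]. Qed.

Let dPhi i x : interior_box T x -> is_derive x (delta_mx 0 i) (Phi i) (A i x + B i x).
Proof.
move=> Tx.
have dF j : is_derive x (delta_mx 0 i) (fun y => flux S (Ub y) i j)
    (source S (Ub x) ('D_(delta_mx 0 i) f x *: delta_mx 0 i) 0 j).
  apply: (@flux_balance _ _ _ HS Ub f x i _ v) => //.
  - apply: near_interior Tx _ => y Ty; split; first exact/aUb/interior_boxW.
    by rewrite -UiniUb ?inE// -wf ?inE//; exact: Vv.
  - exact: cvg_interior Tx cUb.
  - exact: is_derive_C1.
have -> : Phi i = \sum_j ((fun y => flux S (Ub y) i j) * p j).
  by apply/funext => y; rewrite fct_sumE.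
have dsum := is_derive_sum (fun j => is_deriveM (dF j) (is_derive_C1 i x (p1 j))).
apply: is_derive_eq dsum _.
rewrite /A /B -big_split; apply: eq_bigr => j _ /=.
by rewrite /GRing.scale/= (mulrC (p j x)).
Qed.

Let interiorE x : interior_box T x ->
  consvar S (Defs.number S (Uini x)) (eqvar S (Uini x) (w x)) (w x) = Ub x.
Proof.
move=> Tx; rewrite UiniUb ?inE//; apply: consvarK => //.
exact/aUb/interior_boxW.
Qed.

Let cell_flux x : interior_box T x ->
  frobenius (flux S (Ub x)) (gradv phi x) = \sum_i A i x.
Proof.
move=> Tx; apply: eq_bigr => i _; apply: eq_bigr => j _; congr (_ * _).
(* A derivative at an interior point depends only on values near that point, where [phi] agrees with
   its extension. *)
rewrite mxE; apply: near_eq_derive; apply: near_interior Tx _ => y Ty.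
by apply: phip; rewrite inE.
Qed.

Let cell_source x : interior_box T x ->
  dot (source S (Ub x) (grad w x)) (phi x) = \sum_i B i x.
Proof.
move=> Tx; rewrite /B exchange_big; apply: eq_bigr => j _.
rewrite source_sum summxE mulr_suml; apply: eq_bigr => i _.
have -> : phi x 0 j = p j x by apply: (@phip j); rewrite inE.
congr (source S _ (_ *: _) 0 j * _); rewrite mxE; apply: near_eq_derive.
by apply: near_interior Tx _ => y Ty; rewrite wf// inE.
Qed.

Let face_trace i up x : on_face T i up x ->
  trace_int Uini x (face_normal i up) = Ub x.
Proof. by move=> xf; apply: trace_intE xf _ _ => //; exact: norm_hausdorff. Qed.

Let face_phi i up x : on_face T i up x ->
  trace_int phi x (face_normal i up) = \row_j p j x.
Proof.
move=> xf; apply: (@trace_intE _ _ _ T i up x phi (fun x => \row_j p j x)) => //.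
- by move=> y Ty; apply/rowP => j; rewrite mxE; exact: phip.
- apply: continuous_subspaceT => y; apply/(@cvg_mxP _ _ _ (nbhs_filter y)) => k j; rewrite mxE.
  by under [fun _ => _]eq_fun do rewrite mxE; case: (p1 j) => + _ _; apply.
Qed.

(** Once the interface flux is that of the interior trace, the right-hand side is the integral of
    the divergence of [Phi] minus its outward flux. *)
Lemma rhs_equilibrium :
  (forall i up x, on_face T i up x ->
    hr_flux S Fhat w (fun x => Defs.number S (Uini x)) (fun x => eqvar S (Uini x) (w x))
      x (face_normal i up)
    = face_normal i up *m flux S (trace_int Uini x (face_normal i up))) ->
  rhs S Fhat w (fun x => Defs.number S (Uini x)) (fun x => eqvar S (Uini x) (w x)) T phi = 0.
Proof.
move=> hr; rewrite /rhs.
rewrite (@eq_cell_integral _ _ _ _ (fun x => \sum_i A i x)); last first.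
  by move=> x; rewrite inE => Tx; rewrite interiorE//; exact: cell_flux.
rewrite [X in _ + X](@eq_cell_integral _ _ _ _ (fun x => \sum_i B i x)); last first.
  by move=> x; rewrite inE => Tx; rewrite interiorE//; exact: cell_source.
rewrite (@eq_boundary_integral _ _ _ _ (fun x n => \sum_i n 0 i * Phi i x)); last first.
  move=> i up x xf; rewrite hr// face_trace// face_phi//.
  rewrite /dot; under eq_bigr do rewrite !mxE mulr_suml.
  rewrite exchange_big; apply: eq_bigr => l _; rewrite mulr_sumr.
  by apply: eq_bigr => j _; rewrite mulrA.
have csum (F : 'I_d -> 'rV[R]_d -> R) : (forall i, {within closed_box T, continuous (F i)}) ->
    {within closed_box T, continuous (fun x => \sum_i F i x)}.
  move=> cF x; apply: cvg_big => [|i _]; [exact: add_continuous|exact: cF].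
rewrite addrAC -cell_integralD//; [|exact: csum..].
rewrite (@eq_cell_integral _ _ _ _ (fun x => \sum_i (A i x + B i x))); last first.
  by move=> x _; rewrite big_split.
rewrite (divergence_box T0 cPhi _ dPhi) ?subrr// => i x.
by apply: cvgD; [exact: cA|exact: cB].
Qed.

End OneCell.

End CellBalance.

(** * From cells to the whole mesh *)

Section Exactness.
Context {R : realType} {d : nat}.
Variables (S : system R d) (K : mesh R d).
Variable (Fhat : state R d -> state R d -> 'rV[R]_d -> state R d).
Hypothesis HS : equilibrium_system S.
Variables (w : 'rV[R]_d -> R) (Uini : 'rV[R]_d -> state R d).

Lemma dot_face_normal (i : 'I_d) up : dot (face_normal i up) (face_normal i up) = 1 :> R.
Proof.
rewrite /dot (sum_face_normal i up (fun l => face_normal i up 0 l)) face_normalE eqxx.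
by case: up; rewrite ?mulr1 ?mulN1r ?opprK.
Qed.

(** The scheme takes traces of [V] and of the Mach number, the hypotheses those of the conservative
    state; continuity at admissible states makes the two agree. *)
Lemma face_hr_flux T i up x f : proper_box T -> on_face T i up x ->
  C1 f -> {in interior_box T, w =1 f} -> regular_in_cell S T Uini ->
  regular_exterior S w Uini x (face_normal i up) -> consistent_flux S Fhat ->
  smooth_at S w Uini x (face_normal i up) \/
    (shock_at S w Uini x (face_normal i up) /\ (roe_flux S Fhat \/ hllc_flux S Fhat)) ->
  hr_flux S Fhat w (fun x => Defs.number S (Uini x)) (fun x => eqvar S (Uini x) (w x))
      x (face_normal i up)
    = face_normal i up *m flux S (trace_int Uini x (face_normal i up)).
Proof.
move=> T0 xf f1 wf [Ub UU [cUb aUb]] [cUE cwE aE] cFhat link.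
set n := face_normal i up in cUE cwE aE link *.
have cUI := cvg_trace_int T0 xf UU cUb.
have cwI : w (x - e *: n) @[e --> (0 : R)^'+] --> f x.
  by apply: cvg_trace_int T0 xf wf _; apply: continuous_subspaceT; case: f1.
have UI : trace_int Uini x n = Ub x by apply/cvg_lim => //; exact: norm_hausdorff.
have wI : trace_int w x n = f x by apply/cvg_lim.
have aI : adm S (Ub x) by apply/aUb/(face_closed T0 xf).
have VI : trace_int (fun x => eqvar S (Uini x) (w x)) x n = eqvar S (Ub x) (f x).
  by apply/cvg_lim; [exact: norm_hausdorff|exact: (cvg_eqvar HS _ aI cUI cwI)].
have MI : trace_int (fun x => Defs.number S (Uini x)) x n = Defs.number S (Ub x).
  by apply/cvg_lim => //; exact: (cvg_number HS _ aI cUI).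
have VE : trace_ext (fun x => eqvar S (Uini x) (w x)) x n =
    eqvar S (trace_ext Uini x n) (trace_ext w x n).
  by apply/cvg_lim; [exact: norm_hausdorff|exact: (cvg_eqvar HS _ aE cUE cwE)].
have ME : trace_ext (fun x => Defs.number S (Uini x)) x n = Defs.number S (trace_ext Uini x n).
  by apply/cvg_lim => //; exact: (cvg_number HS _ aE cUE).
rewrite /hr_flux VI MI VE ME wI UI consvarK//.
rewrite hr_flux_stationary ?subrr ?add0r//; first exact: dot_face_normal.
case: link => [[VV reg]|[[ww sh] fl]]; [left|right].
  by move: VV reg; rewrite UI wI.
rewrite -wI; split => //; move: sh; rewrite UI => sh.
have nn := dot_face_normal i up.
case: fl => fl; last exact: hllc_stationary.
by apply: roe_stationary => //; case: sh => -[].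
Qed.

(** The constant [v] may differ from cell to cell, which leaves room for shocks. A vanishing
    right-hand side makes the state, constant in time, a solution of the scheme. *)
Theorem equilibrium_exact k : piecewise_C1 K w -> consistent_flux S Fhat ->
  (forall T, is_cell K T -> exists2 v, isotropic (cmid v) &
    [/\ regular_in_cell S T Uini,
      (forall x, interior_box T x -> eqvar S (Uini x) (w x) = v) &
      forall i up x, on_face T i up x ->
        regular_exterior S w Uini x (face_normal i up) /\
        (smooth_at S w Uini x (face_normal i up) \/
          (shock_at S w Uini x (face_normal i up) /\
           (roe_flux S Fhat \/ hllc_flux S Fhat)))]) ->
  exact_for S K k Fhat w Uini.
Proof.
move=> wC1 cFhat eqU.
have V0h : V_h K k (fun x => eqvar S (Uini x) (w x)).
  move=> j T /eqU[v _ [_ Vv _]]; exists (fun=> v 0 j); first exact: polynomial_cst.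
  by move=> x; rewrite inE => /Vv ->.
have rhs0 T phi : is_cell K T -> V_h K k phi ->
    rhs S Fhat w (fun x => Defs.number S (Uini x)) (fun x => eqvar S (Uini x) (w x)) T phi = 0.
  move=> TK phiK; have T0 := is_cell_proper_box TK.
  have [v iso [reg Vv face]] := eqU T TK.
  have [f f1 wf] := wC1 T TK.
  have /choice[p pP] j : exists q, C1 q /\ {in interior_box T, (fun x => phi x 0 j) =1 q}.
    by have [q /polynomial_C1 q1 qE] := phiK j T TK; exists q.
  have [Ub UU [cUb aUb]] := reg.
  apply: (@rhs_equilibrium _ _ S Fhat HS T w f Uini Ub v phi p) => //.
  - by move=> j; case: (pP j).
  - by move=> j; case: (pP j).
  - move=> i up x xf; have [rE link] := face i up x xf.
    exact: (face_hr_flux T0 xf f1 wf reg rE cFhat link).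
split => // t; split => // T phi TK phiK; rewrite rhs0//.
exact: is_derive_cst.
Qed.

End Exactness.

(** At zero momentum the two rest quantities determine [V], and the Mach number is 0 on both sides
    of every interface. A hydrostatic state is thus cellwise constant in [V] with smooth
    interfaces. *)
Lemma hydrostatic_moving (R : realType) (d : nat) (S : system R d) (K : mesh R d)
    (w : 'rV[R]_d -> R) Uini T :
  equilibrium_system S -> piecewise_C1 K w -> hydrostatic_equilibrium S K w Uini ->
  is_cell K T ->
  exists2 v, cmid v = 0 &
    [/\ regular_in_cell S T Uini,
      (forall x, interior_box T x -> eqvar S (Uini x) (w x) = v) &
      forall i up x, on_face T i up x ->
        regular_exterior S w Uini x (face_normal i up) /\
        smooth_at S w Uini x (face_normal i up)].
Proof.
move=> HS wC1 [c hyd] TK; have [reg rest_c face] := hyd T TK.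
have T0 := is_cell_proper_box TK.
have [f f1 wf] := wC1 T TK.
have [Ub UU [cUb aUb]] := reg.
(* The centre of the cell serves as a reference point at which to read off the constant value of
   [V]. *)
pose x0 : 'rV[R]_d := \row_i ((lo T 0 i + hi T 0 i) / 2).
have Tx0 : interior_box T x0.
  by move=> i; rewrite mxE; have := T0 i => lohi; apply/andP; split; lra.
have aT x : interior_box T x -> adm S (Uini x).
  by move=> Tx; rewrite UU ?inE//; exact/aUb/interior_boxW.
have [m0 r0] := rest_c _ Tx0.
have Vv x : interior_box T x -> eqvar S (Uini x) (w x) = eqvar S (Uini x0) (w x0).
  move=> Tx; have [mx rx] := rest_c _ Tx.
  by apply: (eqvar_rest HS) => //; [exact: aT|exact: aT|rewrite rx r0].
exists (eqvar S (Uini x0) (w x0)); first by rewrite (cmid_eqvar HS).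
split => // i up x xf; have [rE mE rEc] := face i up x xf; split => //.
set n := face_normal i up in rE mE rEc *.
have cUI := cvg_trace_int T0 xf UU cUb.
have cwI : w (x - e *: n) @[e --> (0 : R)^'+] --> f x.
  by apply: cvg_trace_int T0 xf wf _; apply: continuous_subspaceT; case: f1.
have UI : trace_int Uini x n = Ub x by apply/cvg_lim => //; exact: norm_hausdorff.
have wI : trace_int w x n = f x by apply/cvg_lim.
have aI : adm S (Ub x) by apply/aUb/(face_closed T0 xf).
have VI : eqvar S (Ub x) (f x) = eqvar S (Uini x0) (w x0).
  (* On the face, [V] is the limit of its constant values along the inward segment. *)
  have cV := cvg_eqvar HS (at_right_proper_filter 0) aI cUI cwI.
  rewrite -(cvg_lim (@norm_hausdorff _ _) cV); apply/cvg_lim; first exact: norm_hausdorff.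
  apply: cvg_near_cst.
  by apply: filterS (near_face T0 xf) => e /Vv.
have mI : cmid (Ub x) = 0 by rewrite -(cmid_eqvar HS _ (f x)) VI (cmid_eqvar HS).
split; last by rewrite UI !(number_rest HS)//; exact: same_regime_refl.
rewrite UI wI VI; case: rE => _ _ aE.
apply: (eqvar_rest HS) => //; first exact: aT.
by rewrite rEc r0.
Qed.

Theorem theorem3p1 (R : realType) (gamma g : R) (hgamma : 1 < gamma)
  (hg : 0 < g) (k : nat) :
  (forall (S : system R 1) (K : mesh R 1) (w : 'rV[R]_1 -> R)
     (Uini : 'rV[R]_1 -> state R 1)
     (Fhat : state R 1 -> state R 1 -> 'rV[R]_1 -> state R 1),
     S = euler gamma 1 \/ S = ripa g 1 ->
     piecewise_C1 K w ->
     consistent_flux S Fhat ->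
     moving_equilibrium S K w Uini \/
       (moving_equilibrium_with_shocks S K w Uini /\
        (roe_flux S Fhat \/ hllc_flux S Fhat)) ->
     exact_for S K k Fhat w Uini) /\
  (forall (S : system R 2) (K : mesh R 2) (w : 'rV[R]_2 -> R)
     (Uini : 'rV[R]_2 -> state R 2)
     (Fhat : state R 2 -> state R 2 -> 'rV[R]_2 -> state R 2),
     S = euler gamma 2 \/ S = ripa g 2 ->
     piecewise_C1 K w ->
     consistent_flux S Fhat ->
     hydrostatic_equilibrium S K w Uini ->
     exact_for S K k Fhat w Uini).
Proof.
have system_eq d (S : system R d) : S = euler gamma d \/ S = ripa g d -> equilibrium_system S.
  by move=> [->|->]; [exact: euler_equilibrium_system|exact: ripa_equilibrium_system].
split=> S K w Uini Fhat /system_eq HS wC1 cFhat eqU; apply: equilibrium_exact => // T TK.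
  case: eqU => [eqU|[eqU RH]]; have [reg [v Vv] face] := eqU T TK.
    by exists v; [exact: isotropic1|split => // i up x /face[]; split => //; left].
  exists v; first exact: isotropic1.
  by split => // i up x /face[rE [sm|sh]]; split => //; [left|right].
have [v v0 [reg Vv face]] := hydrostatic_moving HS wC1 eqU TK.
exists v; first by rewrite v0; exact: isotropic0.
by split => // i up x /face[]; split => //; left.
Qed.
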